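(* Let $f:[0,\infty)\to\mathbb{R}$ be Lipschitz continuous and $p_M>0$. Traveling waves of the limit problem (with speed $c\in\mathbb{R}$ and right limit $\ell$) are defined in the context. They are classified as follows. A. Suppose $f$ is bistable: there is $\alpha\in(0,p_M)$ with $f>0$ in $(\alpha,p_M)$ and $f<0$ in $[0,\alpha)\cup(p_M,\infty)$. (i) If $\int_0^{p_M}f(p)\,dp<0$, then there exist no traveling waves (for any $c\in\mathbb{R}$). (ii) If $\int_0^{p_M}f(p)\,dp=0$, then there exists a traveling wave for every $c\le0$. If $c<0$ then $\mathrm{Supp}\,\bar\rho=\mathbb{R}$, while for $c=0$ we have (up to translation) $\mathrm{Supp}\,\bar\rho=(-\infty,0)$. In both cases $\ell=0$. (iii) If $\int_0^{p_M}f(p)\,dp>0$, then there exists a unique (up to translation) traveling wave. It satisfies the boundary conditions with $\ell=0$ and its speed is $$c^*:=\left(2\int_0^{p_M}f(p)\,dp\right)^{1/2}.$$ B. Suppose $f$ is monostable: $f(0)=0$, $f>0$ in $(0,p_M)$ and $f<0$ in $(p_M,\infty)$. Then for every $\ell\in[0,1)$ there exists a unique (up to translation) traveling wave with non-zero speed satisfying the boundary conditions with this $\ell$. Its speed is $$c(\ell)=\frac{1}{1-\ell}\left(2\int_0^{p_M}f(p)\,dp\right)^{1/2}\ge c^*:=\left(2\int_0^{p_M}f(p)\,dp\right)^{1/2}.$$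
   Context: The limit problem is $\partial_t\rho=\partial_{xx}p+\rho f(p)$, $p\in P_\infty(\rho)$ on $\mathbb{R}$, where $P_\infty$ is the Hele-Shaw graph: $P_\infty(\rho)=\{0\}$ if $\rho<1$, $[0,\infty)$ if $\rho=1$, $\{\infty\}$ if $\rho>1$. Definition. A pair $(\bar\rho(x),\bar p(x))$ of functions on $\mathbb{R}$ is a traveling wave of the limit problem if $\bar\rho$ and $\bar p$ are non-increasing and there exists $c\in\mathbb{R}$ (the speed) such that $$-c\,\bar\rho'=\bar p''+\bar\rho f(\bar p),\qquad\bar p\in P_\infty(\bar\rho)$$ in the sense of distributions (the graph condition holding a.e.), with the boundary conditions $$\lim_{x\to-\infty}\bar\rho=1,\quad\lim_{x\to+\infty}\bar\rho=\ell,\quad\lim_{x\to-\infty}\bar p=p_M,\quad\lim_{x\to+\infty}\bar p=0,$$ where $\ell=0$ in the bistable case and $\ell\in[0,1)$ in the monostable case. $\mathrm{Supp}\,\bar\rho$ stands for the set where $\bar\rho>0$ (up to a null set). *)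

(* Defs.v *)
From HB Require Import structures.
From mathcomp Require Import all_boot all_order all_algebra.
From mathcomp Require Import all_classical all_reals all_analysis.

Set Implicit Arguments.
Unset Strict Implicit.
Unset Printing Implicit Defensive.

Import Order.TTheory GRing.Theory Num.Theory.
Import numFieldNormedType.Exports.

Local Open Scope ring_scope.
Local Open Scope classical_set_scope.

Section TravelingWaves.
Variable R : realType.
Implicit Types (f rho p phi : R -> R) (pM l c : R).

Local Notation mu := (@lebesgue_measure R).

(* A nonlinearity on [0, oo) is a total function [f] of which only the values
   on [0, oo) are constrained. The pressure of a traveling wave is nonnegative
   (it is non-increasing with limit 0 at +oo), so the other values of [f] never
   matter. *)
Definition bistable f pM : Prop :=
  exists alpha : R,
    [/\ 0 < alpha < pM,
        (forall u, alpha < u < pM -> 0 < f u),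
        (forall u, 0 <= u < alpha -> f u < 0) &
        (forall u, pM < u -> f u < 0)].

Definition monostable f pM : Prop :=
  [/\ f 0 = 0,
      (forall u, 0 < u < pM -> 0 < f u) &
      (forall u, pM < u -> f u < 0)].

(* The pressure takes the value +oo on the branch r > 1, hence the codomain. *)
Definition hele_shaw_graph (r : R) : set (\bar R) :=
  if r < 1 then [set 0%:E]
  else if r == 1 then [set y | (0 <= y < +oo)%E]
  else [set +oo%E].

Definition test_function phi : Prop :=
  (forall (n : nat) (x : R), derivable (phi^`(n)) x 1) /\
  compact (closure [set x | phi x != 0]).

Definition pairing (u phi : R -> R) : R := \int[mu]_x (u x * phi x).

(* - c rho' = p'' + rho f(p) in the sense of distributions: all derivatives are
   moved onto the test function, the first order term changing sign. *)
Definition weak_solution f c rho p : Prop :=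
  forall phi, test_function phi ->
    c * pairing rho phi^`() =
    pairing p phi^`(2) + pairing (fun x => rho x * f (p x)) phi.

Definition traveling_wave f pM l c rho p : Prop :=
  [/\ nonincreasing_fun rho,
      nonincreasing_fun p,
      weak_solution f c rho p,
      \forall x \ae mu, hele_shaw_graph (rho x) (p x)%:E &
      [/\ rho x @[x --> -oo] --> (1 : R),
          rho x @[x --> +oo] --> l,
          p x @[x --> -oo] --> pM &
          p x @[x --> +oo] --> (0 : R)]].

Definition supp_ae rho (A : set R) : Prop :=
  \forall x \ae mu, 0 < rho x <-> A x.

(* The wave profiles are identified when they agree almost everywhere: the value
   of [rho] at its jump is not determined by the problem. *)
Definition translates rho1 p1 rho2 p2 : Prop :=
  exists h : R, (\forall x \ae mu, rho2 x = rho1 (x + h)) /\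
                (\forall x \ae mu, p2 x = p1 (x + h)).

Definition unique_up_to_translation (W : (R -> R) -> (R -> R) -> Prop) : Prop :=
  (exists rho p, W rho p) /\
  (forall rho1 p1 rho2 p2, W rho1 p1 -> W rho2 p2 -> translates rho1 p1 rho2 p2).

Definition reaction_integral f pM : R := \int[mu]_(u in `[0, pM]) f u.

Definition cstar f pM : R := Num.sqrt (2 * reaction_integral f pM).

End TravelingWaves.

(* Main.v *)
Require Import Defs.
From HB Require Import structures.
From mathcomp Require Import all_boot all_order all_algebra.
From mathcomp Require Import all_classical all_reals all_analysis.
From mathcomp Require Import measurable_realfun.
From mathcomp Require Import ring lra.

Set Implicit Arguments.
Unset Strict Implicit.
Unset Printing Implicit Defensive.

Import Order.TTheory GRing.Theory Num.Theory.
Import numFieldNormedType.Exports.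

Local Open Scope ring_scope.
Local Open Scope classical_set_scope.

(* Let x0 = sup {p > 0}. The graph condition forces rho = 1 to the left of x0, and
   p = 0 to its right. Testing with smooth ramps (du Bois-Reymond) turns the
   distributional equation into: p + (a primitive of c rho + W) is affine, where
   W is a primitive of rho f(p). Hence p is continuous, p'' = - f(p) on (-oo, x0),
   p'(x0-) = - c (1 - rho(x0+)), and rho solves - c rho' = f(0) rho on (x0, oo).
   With gap u = int_u^pM f, the energy p'^2 / 2 - gap p vanishes at -oo, so
   p' = - sqrt (2 gap p), and at x0 this gives
   c (1 - rho(x0+)) = sqrt (2 int_0^pM f), which decides the sign and the value of
   the speed. A primitive Y of (2 gap)^(-1/2) satisfies Y(p x) + x = constant,
   which gives uniqueness of the profile; inverting Y gives its existence.
   The function [fun u => f (Num.max u 0)] replaces [f], which is arbitrary on the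
   negative half-line. *)

(** * Calculus on intervals *)

Section calculus.
Context {R : realType}.
Implicit Types (f g : R -> R) (I : set R) (x y l : R).
Local Notation mu := (@lebesgue_measure R).

(** The jump relation settles the classification only jointly with the sign of f 0 / c and the
    monotonicity of rho. In the bistable case f 0 < 0. If gap 0 > 0, then c > 0 and the tail
    equation would make rho increase, so the tail is zero and the speed is [cstar]. If gap 0 = 0, a
    nonzero c must have rho(x0+) = 1; for c < 0 the tail then decays exponentially without
    vanishing, while c = 0 degenerates the tail equation into rho f 0 = 0. In the monostable case f
    0 = 0, so the tail is the constant l and the speed depends on l.

    The equation p' = - sqrt (2 gap p) may fail to be Lipschitz at the ends of [0, pM], and its
    behaviour there needs two estimates. The profile never attains pM at finite distance because gap
    u <= K (pM - u)^2 / 2, where K is the Lipschitz constant of f. It attains 0 at finite distance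
    because gap u >= k u near 0, either since gap 0 > 0 or since gap 0 = 0 and f 0 < 0.

    Smooth compactly supported functions are built by hand from exp(-1/x), since the weak equation
    is available only against them. *)

Lemma is_derive_continuous f x l : is_derive x 1 f l -> {for x, continuous f}.
Proof. by move=> [df _]; apply/differentiable_continuous/derivable1_diffP. Qed.

Lemma is_derive_near_eq f g x l :
  (\forall y \near x, f y = g y) -> is_derive x 1 f l -> is_derive x 1 g l.
Proof. by apply: near_eq_is_derive; rewrite oner_eq0. Qed.

Lemma is_derive1E f x l : is_derive x 1 f l -> f^`() x = l.
Proof. by move=> [_ <-]; rewrite derive1E. Qed.

Lemma is_derive_affine (a b : R) x : is_derive x 1 (fun y => a + b * y) b.
Proof.
have := is_deriveD (is_derive_cst a x 1) (is_deriveZ b (is_derive_id x 1)).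
by rewrite add0r /GRing.scale/= mulr1.
Qed.

(** Differentiability is asked at every point of [I], so that a single form serves half-lines, open
    intervals and segments. *)
Lemma mvt_itv I f f' x y : is_interval I ->
    (forall z, I z -> is_derive z 1 f (f' z)) -> I x -> I y -> x < y ->
  exists2 z, x < z < y & f y - f x = f' z * (y - x).
Proof.
move=> itvI df Ix Iy xy; have Iz z : x <= z <= y -> I z by apply: itvI.
have [z0|z0|] := @MVT R f f' x y xy.
- by rewrite in_itv/= => /andP[/ltW xz /ltW zy]; apply/df/Iz/andP.
- apply: continuous_in_subspaceT => z; rewrite inE/= in_itv/= => xzy.
  exact: (is_derive_continuous (df _ (Iz _ xzy))).
by move=> z; rewrite in_itv/= => ? ?; exists z.
Qed.

Lemma derive0_cst_itv I f x y : is_interval I ->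
  (forall z, I z -> is_derive z 1 f 0) -> I x -> I y -> f x = f y.
Proof.
move=> itvI df; wlog xy : x y / x < y.
  by move=> h Ix Iy; have [/h->//|/h->//|->//] := ltgtP x y.
move=> Ix Iy; have [z _] := mvt_itv itvI df Ix Iy xy.
by rewrite mul0r => /eqP; rewrite subr_eq0 => /eqP.
Qed.

Lemma derive_ge0_le_itv I f f' x y : is_interval I ->
  (forall z, I z -> is_derive z 1 f (f' z)) -> (forall z, I z -> 0 <= f' z) ->
  I x -> I y -> x <= y -> f x <= f y.
Proof.
move=> itvI df f'0 Ix Iy; rewrite le_eqVlt => /predU1P[->//|xy].
have [z /andP[xz zy] e] := mvt_itv itvI df Ix Iy xy.
rewrite -subr_ge0 e mulr_ge0 ?subr_ge0 ?(ltW xy)// f'0//.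
by apply: itvI Ix Iy _ _; rewrite !ltW.
Qed.

Lemma derive_gt0_lt_itv I f f' x y : is_interval I ->
  (forall z, I z -> is_derive z 1 f (f' z)) -> (forall z, I z -> 0 < f' z) ->
  I x -> I y -> x < y -> f x < f y.
Proof.
move=> itvI df f'0 Ix Iy xy.
have [z /andP[xz zy] e] := mvt_itv itvI df Ix Iy xy.
rewrite -subr_gt0 e mulr_gt0 ?subr_gt0// f'0//.
by apply: itvI Ix Iy _ _; rewrite !ltW.
Qed.

Lemma open_enlarge I x : open I -> I x ->
  exists d u, [/\ d < x, x < u, I d & I u].
Proof.
move=> oI Ix; have /nbhs_ballP[e/= e0 eI] := open_nbhs_nbhs (conj oI Ix).
exists (x - e / 2), (x + e / 2).
have e20 : 0 < e / 2 by rewrite divr_gt0.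
have e2e : e / 2 < e by rewrite ltr_pdivrMr// ltr_pMr// ltr1n.
split; rewrite ?ltrBlDr ?ltrDl//; apply: eI; rewrite /ball/=.
  by rewrite opprB addrC subrK gtr0_norm.
by rewrite opprD addrA subrr sub0r normrN gtr0_norm.
Qed.

Lemma continuous_itv_integrable I g d u : is_interval I ->
  {in I, continuous g} -> I d -> I u -> mu.-integrable `[d, u] (EFin \o g).
Proof.
move=> itvI cg Id Iu.
apply: continuous_compact_integrable; first exact: segment_compact.
apply: continuous_in_subspaceT => z; rewrite inE/= in_itv/= => dzu.
by apply: cg; rewrite inE; apply: itvI dzu.
Qed.

(** Openness of [I] matters for the slowness (2 gap)^(-1/2), which may blow up at the ends of ]0,
    pM[ but is continuous inside. *)
Lemma antiderivative_itv I g : open I -> is_interval I ->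
  {in I, continuous g} -> exists G, forall x, I x -> is_derive x 1 G (g x).
Proof.
move=> oI itvI cg; have [[c Ic]|I0] := pselect (I !=set0); last first.
  by exists g => x Ix; exfalso; apply: I0; exists x.
pose G x := if c <= x then \int[mu]_(t in `[c, x]) g t
            else - \int[mu]_(t in `[x, c]) g t.
exists G => x Ix.
(* With a base point [d] to the left of both [x] and [c], the two branches of [G] become one
   integral from [d] minus a constant. *)
have [d [u [dx xu Id Iu]]] : exists d u,
    [/\ d < Num.min x c, Num.max x c < u, I d & I u].
  have [d1 [u1 [? ? ? ?]]] := open_enlarge oI Ix.
  have [d2 [u2 [? ? ? ?]]] := open_enlarge oI Ic.
  exists (Num.min d1 d2), (Num.max u1 u2); split.
  - by rewrite lt_min !gt_min; apply/andP; split; apply/orP; [left|right].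
  - by rewrite gt_max !lt_max; apply/andP; split; apply/orP; [left|right].
  - by rewrite /Num.min; case: ifP.
  - by rewrite /Num.max; case: ifP.
have /andP[{}dx dc] : (d < x) && (d < c) by rewrite -lt_min.
have /andP[{}xu cu] : (x < u) && (c < u) by rewrite -gt_max.
have intg := continuous_itv_integrable itvI cg Id Iu.
have split_int a b : d <= a -> a <= b -> b <= u ->
    \int[mu]_(t in `[d, b]) g t - \int[mu]_(t in `[d, a]) g t =
    \int[mu]_(t in `[a, b]) g t.
  move=> da ab bu.
  have intdb : mu.-integrable `[d, b] (EFin \o g).
    by apply: integrableS intg => //; apply: subset_itvl; rewrite bnd_simp.
  rewrite Rintegral_itvB ?bnd_simp//; apply: Rintegral_itv_obnd_cbnd.
  by apply: integrableS intdb => //; apply: subset_itvr; rewrite bnd_simp.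
apply: (@is_derive_near_eq (fun y => \int[mu]_(t in `[d, y]) g t -
    \int[mu]_(t in `[d, c]) g t)); last first.
  have [d1 d2] := @continuous_FTC1_closed R g d x u xu intg dx
    (cg _ (mem_set Ix)).
  rewrite -[g x]subr0; apply: is_deriveB.
  apply: DeriveDef.
    exact: d1.
  rewrite -derive1E.
  exact: d2.
near=> y; have dy : d <= y by near: y; exact: lt_le_nbhsr.
have yu : y <= u by near: y; exact: lt_le_nbhsl.
rewrite /G; have [cy|/ltW yc] := leP c y.
  exact: (split_int _ _ (ltW dc) cy yu).
by apply: oppr_inj; rewrite opprB opprK; exact: (split_int _ _ dy yc (ltW cu)).
Unshelve. all: by end_near. Qed.

Lemma antiderivative g : continuous g ->
  exists G, forall x, is_derive x 1 G (g x).
Proof.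
move=> cg; have [G dG] := @antiderivative_itv setT g openT
  (fun _ _ _ _ _ _ => I) (fun x _ => cg x).
by exists G => x; exact: dG.
Qed.

End calculus.

(** * Smooth ramps *)

Section smooth_functions.
Context {R : realType}.
Implicit Types (f g : R -> R) (x y z : R) (P : {poly R}).

Lemma expX_expRN_le n y : 0 <= y -> y ^+ n * expR (- y) <= n`!%:R.
Proof.
move=> y0; rewrite expRN ler_pdivrMr ?expR_gt0//; case: n => [|n].
  by rewrite fact0 mul1r expr0 -expR0 ler_expR.
rewrite mulrC -ler_pdivrMr ?ltr0n ?fact_gt0//.
by rewrite (le_trans _ (expR_ge1Dxn n y0))// lerDr.
Qed.

Lemma horner_expRN_bound P :
  exists C : R, forall y, 0 <= y -> `|P.[y] * expR (- y)| <= C.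
Proof.
exists (\sum_(i < size P) `|P`_i| * i`!%:R) => y y0.
rewrite horner_coef mulr_suml (le_trans (ler_norm_sum _ _ _))//.
apply: ler_sum => i _; rewrite -mulrA normrM ler_wpM2l//.
by rewrite ger0_norm ?mulr_ge0 ?exprn_ge0 ?expR_ge0// expX_expRN_le.
Qed.

(** Serves at the gluing point 0 of the flat functions, where the differentiation rules do not
    apply. *)
Lemma is_derive_quadratic f x C :
  (forall z, `|f z - f x| <= C * `|z - x| ^+ 2) -> is_derive x 1 f 0.
Proof.
move=> fC; apply/is_derive1_caratheodory.
exists (fun z => (f z - f x) / (z - x)); split.
- move=> z; have [->|zx] := eqVneq z x; first by rewrite !subrr mulr0.
  by rewrite divfK ?subr_eq0.
- rewrite /prop_for /continuous_at subrr mul0r.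
  apply/cvgr0Pnorm_lt => e e0; near=> z.
  have [->|zx] := eqVneq z x; first by rewrite subrr mul0r normr0.
  have zx0 : 0 < `|z - x| by rewrite normr_gt0 subr_eq0.
  rewrite normrM normfV ltr_pdivrMr// (le_lt_trans (fC z))// expr2 mulrA.
  rewrite ltr_pM2r// (@le_lt_trans _ _ ((`|C| + 1) * `|z - x|))//.
    by rewrite ler_wpM2r// (le_trans (ler_norm _))// lerDl.
  rewrite mulrC -ltr_pdivlMr ?ltr_wpDl//.
  near: z; apply: (@cvgr_distC_lt _ _ _ (nbhs x) _ id x) => //.
  by rewrite divr_gt0// ltr_wpDl.
- by rewrite subrr mul0r.
Unshelve. all: by end_near. Qed.

(* The polynomial factor makes the family stable under derivation. *)
Definition flat P x := if 0 < x then P.[x^-1] * expR (- x^-1) else 0.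

(** In the variable y = 1/x one has dy/dx = - y^2, and (P exp(-y))' = (P' - P) exp(-y). *)
Lemma is_derive_flat P x : is_derive x 1 (flat P) (flat ('X^2 * (P - P^`())) x).
Proof.
have [x0|x0|->] := ltgtP x 0.
- rewrite [X in is_derive _ _ _ X]/flat ltNge (ltW x0)/=.
  apply: (@is_derive_near_eq _ (cst 0)); near=> y.
  by rewrite /flat/= ltNge ltW//=; near: y; exact: lt_nbhsl.
- rewrite [X in is_derive _ _ _ X]/flat x0.
  apply: (@is_derive_near_eq _ ((horner P \o GRing.inv) *
      (expR \o (-%R \o GRing.inv)))); first near=> y.
    by rewrite /flat ifT//; near: y; exact: lt_nbhsr.
  have dV : is_derive x 1 GRing.inv (- x ^- 2).
    have := @is_deriveV R id x 1 1 (lt0r_neq0 x0) (is_derive_id _ _).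
    by rewrite /GRing.scale/= mulr1.
  apply: is_derive_eq.
  rewrite /GRing.scale/= !hornerE/= -!exprVn; ring.
- rewrite [X in is_derive _ _ _ X]/flat ltxx.
  (* With y = 1/z, flat P z = z^2 (y^2 P(y) exp(-y)), and the bracket is bounded for y >= 0. *)
  have [C PC] := horner_expRN_bound ('X^2 * P).
  apply: (@is_derive_quadratic _ _ `|C|) => z; rewrite /flat ltxx !subr0.
  case: ifPn => z0; last by rewrite normr0 mulr_ge0 ?exprn_ge0.
  have z10 : 0 <= z^-1 by rewrite invr_ge0 ltW.
  have := PC _ z10; rewrite !hornerE/= => {}PC.
  rewrite (@le_trans _ _ (C * `|z| ^+ 2))//.
    rewrite -ler_pdivrMr ?exprn_gt0 ?normr_gt0 ?gt_eqF//.
    rewrite (le_trans _ PC)// le_eqVlt; apply/orP; left; apply/eqP.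
    by rewrite -normrX -normfV -normrM; congr `|_|; rewrite -exprVn; ring.
  by rewrite -mulrA -expr2 ler_wpM2r ?exprn_ge0// ler_norm.
Unshelve. all: by end_near. Qed.

(* Closure under primitives is what allows integrating a bump twice. *)
Inductive smooth_class : (R -> R) -> Prop :=
| smooth_flat P : smooth_class (flat P)
| smooth_cst c : smooth_class (cst c)
| smooth_add f g : smooth_class f -> smooth_class g ->
    smooth_class (fun x => f x + g x)
| smooth_mul f g : smooth_class f -> smooth_class g ->
    smooth_class (fun x => f x * g x)
| smooth_affine a b f : smooth_class f -> smooth_class (fun x => f (a * x + b))
| smooth_primitive f g : smooth_class g ->
    (forall x, is_derive x 1 f (g x)) -> smooth_class f.

Lemma smooth_class_derive f : smooth_class f ->
  exists2 f', smooth_class f' & forall x, is_derive x 1 f (f' x).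
Proof.
elim=> {f}.
- move=> P; exists (flat ('X^2 * (P - P^`()))); first exact: smooth_flat.
  exact: is_derive_flat.
- by move=> c; exists (cst 0); [exact: smooth_cst|move=> x; exact: is_derive_cst].
- move=> f g _ [f' sf' df] _ [g' sg' dg]; exists (fun x => f' x + g' x).
    exact: smooth_add.
  by move=> x; apply: is_deriveD.
- move=> f g sf [f' sf' df] sg [g' sg' dg].
  exists (fun x => f x * g' x + g x * f' x).
    by apply: smooth_add; apply: smooth_mul.
  by move=> x; apply: is_deriveM.
- move=> a b f _ [f' sf' df]; exists (fun x => f' (a * x + b) * a).
    apply: (@smooth_mul (fun x => f' (a * x + b)) (cst a)).
      exact: smooth_affine.
    exact: smooth_cst.
  move=> x; apply: (@is_derive1_comp _ f (fun x => a * x + b)).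
  have -> : (fun x => a * x + b) = (a *: id) + cst b by [].
  by apply: is_derive_eq; rewrite addr0 /GRing.scale/= mulr1.
- by move=> f g sg _ df; exists g.
Qed.

Lemma smooth_class_derive1n n f : smooth_class f -> smooth_class f^`(n).
Proof.
elim: n f => [//|n IH] f /smooth_class_derive[f' sf' df].
rewrite derive1Sn (_ : f^`() = f'); first exact: IH.
by apply/funext => x; exact: is_derive1E.
Qed.

Lemma smooth_class_test_function f a b : smooth_class f ->
  (forall x, f x != 0 -> a <= x <= b) -> test_function f.
Proof.
move=> sf fab; split=> [n x|].
  by have [g _ /(_ x)[]] := smooth_class_derive (smooth_class_derive1n n sf).
apply: (subclosed_compact (@closed_closure _ _) (@segment_compact _ a b)).
rewrite [X in _ `<=` X](closure_id _).1; last exact: interval_closed.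
by apply: closure_subset => x /= /fab; rewrite in_itv.
Qed.

(** The product exp(-1/x) exp(-1/(e - x)), each factor being cut off to 0 on one side. *)
Lemma smooth_bump e : 0 < e -> exists2 h, smooth_class h &
  (forall x, 0 < x < e -> 0 < h x) /\ (forall x, ~~ (0 < x < e) -> h x = 0).
Proof.
move=> e0; exists (fun x => flat 1 x * flat 1 (-1 * x + e)).
  apply: smooth_mul; first exact: smooth_flat.
  by apply: smooth_affine; exact: smooth_flat.
split => x; rewrite /flat mulN1r addrC subr_gt0 !hornerE.
  by move=> /andP[-> ->]; rewrite mulr_gt0// expR_gt0.
by case: (0 < x); case: (x < e) => //= _; rewrite ?mul0r ?mulr0.
Qed.

Lemma smooth_ramp e : 0 < e -> exists T t h : R -> R, exists k,
  [/\ smooth_class T,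
      (forall x, is_derive x 1 T (t x)) /\ (forall x, is_derive x 1 t (h x)),
      (forall x, 0 <= h x) /\ (forall x, ~~ (0 < x < e) -> h x = 0),
      (forall x, x <= 0 -> T x = 0 /\ t x = 0) &
      (forall x, e <= x -> T x = x - k /\ t x = 1)].
Proof.
move=> e0; have [h0 sh0 [h0p h0z]] := smooth_bump e0.
have smc f : smooth_class f -> continuous f.
  by move=> /smooth_class_derive[f' _ df] x; exact: is_derive_continuous (df x).
have h0ge0 x : 0 <= h0 x.
  by have [/h0p/ltW//|/h0z->] := boolP (0 < x < e).
have [A dA] := antiderivative (smc _ sh0).
have A0e : 0 < A e - A 0.
  have [z ze ->] := mvt_itv (fun _ _ _ _ _ _ => I) (fun x (_ : setT x) => dA x) I I e0.
  by rewrite mulr_gt0 ?subr_gt0// h0p.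
(* Normalizes the bump to total mass 1. *)
pose C := (A e - A 0)^-1.
have C0 : 0 <= C by rewrite invr_ge0 ltW.
pose h x := C * h0 x; pose t x := C * (A x - A 0).
have dt x : is_derive x 1 t (h x).
  have -> : t = C *: (A - cst (A 0)) by [].
  by apply: is_derive_eq; rewrite subr0.
have st : smooth_class t.
  apply: (@smooth_primitive _ h) => //.
  by apply: (@smooth_mul (cst C)) => //; exact: smooth_cst.
have [B dB] := antiderivative (smc _ st).
pose T x := B x - B 0.
have dT x : is_derive x 1 T (t x).
  have -> : T = B - cst (B 0) by [].
  by apply: is_derive_eq; rewrite subr0.
exists T, t, h, (e - T e).
have itvN : is_interval [set z : R | z <= 0].
  by move=> a b _ b0 z /andP[_ /le_trans]; exact.
have itvP : is_interval [set z : R | e <= z].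
  by move=> a b ea _ z /andP[az _]; exact: le_trans az.
have t_le0 x : x <= 0 -> t x = 0.
  move=> x0; rewrite /t (_ : A x = A 0) ?subrr ?mulr0//.
  apply: (derive0_cst_itv itvN _ x0 (lexx _)) => z /= z0.
  by rewrite -(h0z z)// ltNge z0.
have t_ge x : e <= x -> t x = 1.
  move=> ex; rewrite /t (_ : A x = A e) ?/C ?mulVf ?gt_eqF//.
  apply: (derive0_cst_itv itvP _ ex (lexx _)) => z /= z0.
  by rewrite -(h0z z)// negb_and orbC -leNgt z0.
split => //.
- exact: (@smooth_primitive _ t).
- split=> x; first by rewrite mulr_ge0.
  by move=> /h0z xe; rewrite /h xe mulr0.
- move=> x x0; split; last exact: t_le0.
  rewrite /T (_ : B x = B 0) ?subrr//.
  apply: (derive0_cst_itv itvN _ x0 (lexx _)) => z /= z0.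
  by rewrite -(t_le0 z).
- move=> x ex; split; last exact: t_ge.
  suff : T x - x = T e - e by move=> /eqP; rewrite subr_eq => /eqP ->; ring.
  apply: (@derive0_cst_itv _ _ (fun x => T x - x) _ _ itvP _ ex (lexx _)).
  move=> z /= ez.
  have -> : (fun x => T x - x) = T - id by [].
  by apply: is_derive_eq; rewrite t_ge// subrr.
Qed.

End smooth_functions.

(** * Primitives of locally bounded functions *)

Section locally_bounded.
Context {R : realType}.
Implicit Types (u w f g : R -> R) (a b k l x y z M : R).
Local Notation mu := (@lebesgue_measure R).

(** A class containing the monotone and the continuous functions, stable under sums, products,
    primitives and composition with continuous functions, in which integrability on segments is
    automatic. *)
Definition locally_bounded_measurable u :=
  measurable_fun [set: R] u /\
  forall a b, exists M, forall x, a <= x <= b -> `|u x| <= M.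

Local Notation lbm := locally_bounded_measurable.

Lemma continuous_lbm u : continuous u -> lbm u.
Proof.
move=> cu; split=> [|a b]; first exact: continuous_measurable_fun.
have ctsu : {within `[a, b], continuous u} by exact: continuous_subspaceT.
have /compact_bounded[M [_ mrt]] := continuous_compact ctsu (@segment_compact _ a b).
exists (M + 1) => x xab; apply: (mrt (M + 1)); first by rewrite ltrDl.
by exists x => //=; rewrite in_itv.
Qed.

Lemma nonincreasing_lbm u : nonincreasing_fun u -> lbm u.
Proof.
move=> du; split=> [|a b]; first exact: nonincreasing_measurable.
exists (`|u a| + `|u b|) => x /andP[/du xa /du bx].
have [u0|u0] := leP 0 (u x).
  by rewrite ger0_norm// (le_trans xa)// (le_trans (ler_norm _))// lerDl.
rewrite ltr0_norm// (@le_trans _ _ (- u b)) ?lerN2//.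
by rewrite (le_trans (ler_norm _))// normrN lerDr.
Qed.

Lemma lbmD u w : lbm u -> lbm w -> lbm (fun x => u x + w x).
Proof.
move=> [mu_ bu] [mw bw]; split=> [|a b]; first exact: measurable_funD.
have [M uM] := bu a b; have [N wN] := bw a b; exists (M + N) => x xab.
by rewrite (le_trans (ler_normD _ _))// lerD ?uM ?wN.
Qed.

Lemma lbmM u w : lbm u -> lbm w -> lbm (fun x => u x * w x).
Proof.
move=> [mu_ bu] [mw bw]; split=> [|a b]; first exact: measurable_funM.
have [M uM] := bu a b; have [N wN] := bw a b; exists (M * N) => x xab.
by rewrite normrM ler_pM ?uM ?wN.
Qed.

Lemma lbm_cst c : lbm (fun=> c).
Proof. by apply: continuous_lbm => x; exact: cvg_cst. Qed.

Lemma lbmZ c u : lbm u -> lbm (fun x => c * u x).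
Proof. by move=> lu; apply: lbmM => //; exact: lbm_cst. Qed.

Lemma lbm_comp g u : continuous g -> lbm u -> lbm (g \o u).
Proof.
move=> cg [mu_ bu]; split=> [|a b].
  by apply: measurableT_comp => //; exact: (continuous_lbm cg).1.
have [M uM] := bu a b; have [N gN] := (continuous_lbm cg).2 (- M) M.
by exists N => x /uM; rewrite ler_norml => /gN.
Qed.

Lemma lbm_integrable u a b : lbm u -> mu.-integrable `[a, b] (EFin \o u).
Proof.
move=> [mu_ bu]; apply: measurable_bounded_integrable => //=.
- by rewrite lebesgue_measure_itv/=; case: ifP => // _; rewrite -EFinD ltry.
- exact: measurable_funTS.
- have [M uM] := bu a b; exists M; split; rewrite ?num_real// => N MN x /=.
  by rewrite in_itv/= => /uM /le_trans -> //; exact: ltW.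
Qed.

Lemma EFin_Rintegral (D : set R) u : measurable D -> mu.-integrable D (EFin \o u) ->
  (\int[mu]_(x in D) u x)%:E = (\int[mu]_(x in D) (u x)%:E)%E.
Proof. by move=> mD iu; rewrite fineK// integrable_fin_num. Qed.

Lemma Rintegral_FTC2 f f' a b : a <= b -> (forall x, is_derive x 1 f (f' x)) ->
  continuous f' -> \int[mu]_(x in `[a, b]) f' x = f b - f a.
Proof.
rewrite le_eqVlt => /predU1P[->|ab] df cf'.
  by rewrite set_itv1 Rintegral_set1 subrr.
have cf x : {for x, continuous f} := is_derive_continuous (df x).
rewrite /Rintegral (@continuous_FTC2 _ f' f)//.
- exact: continuous_subspaceT.
- split=> [x _|//|//]; [by case: (df x)| |].
  + exact/cvg_at_right_filter/cf.
  + exact/cvg_at_left_filter/cf.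
- by move=> x _; rewrite (is_derive1E (df x)).
Qed.

(* Junk value: [prim w a y = 0] for [y < a]. *)
Definition prim w a y := \int[mu]_(x in `[a, y]) w x.

Lemma prim_out w a y : y <= a -> prim w a y = 0.
Proof.
rewrite /prim le_eqVlt => /predU1P[->|ya]; first by rewrite set_itv1 Rintegral_set1.
by rewrite set_itv_ge ?Rintegral_set0// -leNgt bnd_simp.
Qed.

Lemma primB w a y z : lbm w -> a <= y -> y <= z ->
  prim w a z - prim w a y = \int[mu]_(x in `]y, z]) w x.
Proof.
move=> lw ay yz; rewrite /prim Rintegral_itvB ?bnd_simp//.
exact: lbm_integrable.
Qed.

(** Used with k = 0 for the Lipschitz estimate of a primitive, and with k a one-sided limit of [w]
    for its one-sided slope. *)
Lemma prim_bound w a k M y z : lbm w -> a <= y -> y <= z ->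
  (forall x, y < x <= z -> `|w x - k| <= M) ->
  `|prim w a z - prim w a y - k * (z - y)| <= M * (z - y).
Proof.
move=> lw ay yz wM; rewrite primB//.
have iyz u : lbm u -> mu.-integrable `]y, z] (EFin \o u).
  move=> lu; apply: integrableS (lbm_integrable y z lu) => //.
  by apply: subset_itvr; rewrite bnd_simp.
have icst r : \int[mu]_(x in `]y, z]) r = r * (z - y).
  rewrite Rintegral_cst//= lebesgue_measure_itv/= lte_fin.
  by case: ltP => [//|zy]; rewrite mulr0 (@le_anti _ _ y z) ?yz// subrr mulr0.
have lwk : lbm (fun x => w x - k) by apply: lbmD => //; exact: lbm_cst.
rewrite -icst -RintegralB//; [|exact: iyz|exact/iyz/lbm_cst].
rewrite (le_trans (le_normr_Rintegral _ (iyz _ lwk)))// -icst.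
apply: le_Rintegral => //.
- exact: integrable_norm (iyz _ lwk).
- exact: iyz (lbm_cst M).
Qed.

Lemma prim_continuous w a : lbm w -> continuous (prim w a).
Proof.
move=> lw x; have [M wM] := lw.2 a (x + 1).
have lip y z : y <= z -> z <= x + 1 ->
    `|prim w a z - prim w a y| <= (`|M| + 1) * (z - y).
  move=> yz zx; have M0 : 0 <= `|M| + 1 by rewrite addr_ge0.
  have lipa c : a <= c -> c <= z ->
      `|prim w a z - prim w a c| <= (`|M| + 1) * (z - c).
    move=> ac cz; have := @prim_bound w a 0 (`|M| + 1) c z lw ac cz.
    rewrite mul0r subr0; apply=> t /andP[ct tz]; rewrite subr0.
    rewrite (le_trans (wM t _)) ?(le_trans ac (ltW ct)) ?(le_trans tz)//.
    by rewrite (le_trans (ler_norm _))// lerDl.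
  (* To the left of [a] the primitive is constantly 0, its value at [a], so the estimate extends
     across [a]. *)
  have [ay|/ltW ya] := leP a y; first exact: lipa.
  rewrite (prim_out _ ya) -(prim_out w (lexx a)).
  have [az|za] := leP a z.
    by rewrite (le_trans (lipa _ (lexx a) az))// ler_wpM2l// lerB.
  by rewrite !prim_out ?(ltW za)// subrr normr0 mulr_ge0// subr_ge0.
apply/cvgrPdist_le => e e0; near=> y.
have yx1 : y <= x + 1.
  by near: y; apply: lt_le_nbhsl; rewrite ltrDl.
have yx : `|x - y| <= e / (`|M| + 1).
  near: y; apply: (@cvgr_dist_le _ _ _ (nbhs x) _ id x) => //.
  by rewrite divr_gt0// ltr_wpDl.
rewrite (@le_trans _ _ ((`|M| + 1) * `|x - y|))//; last first.
  by rewrite mulrC -ler_pdivlMr// ltr_wpDl.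
have [xy|/ltW xy] := leP x y.
  by rewrite distrC (distrC x) (@ger0_norm _ (y - x)) ?subr_ge0// lip.
by rewrite (@ger0_norm _ (x - y)) ?subr_ge0// lip// lerDl.
Unshelve. all: by end_near. Qed.

(** Extracts a pointwise identity at points where [w] may jump. If the slope differed from [k] by D
    > 0, the estimate of [prim_bound] with M = D / 2 on a short interval would be violated. *)
Lemma prim_right_slope w a x k l : lbm w -> a <= x ->
  w y @[y --> x^'+] --> k ->
  (forall y, x < y -> prim w a y - prim w a x = l * (y - x)) -> l = k.
Proof.
move=> lw ax wk wl; apply/eqP; rewrite -subr_eq0 -normr_eq0 -[_ == 0]negbK normr_eq0.
rewrite -normr_gt0; apply/negP => D0; set D := `|_| in D0.
have D20 : 0 < D / 2 by rewrite divr_gt0.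
have /cvgrPdist_le/(_ _ D20)[e/= e0 we] := wk.
have e20 : 0 < e / 2 by rewrite divr_gt0.
have xy : x < x + e / 2 by rewrite ltrDl.
have := @prim_bound w a k (D / 2) x (x + e / 2) lw ax (ltW xy).
rewrite wl// -mulrBl normrM addrAC subrr add0r (gtr0_norm e20) -/D.
rewrite ler_pM2r// leNgt ltr_pdivrMr// ltr_pMr// ltr1n => /(_ _)/negP[]//.
move=> t /andP[xt te]; rewrite distrC; apply: we => //=.
rewrite distrC gtr0_norm ?subr_gt0// ltrBlDl (le_lt_trans te)// ltrD2l.
by rewrite ltr_pdivrMr// ltr_pMr// ltr1n.
Qed.

Lemma is_derive_prim w a x : lbm w -> a < x -> {for x, continuous w} ->
  is_derive x 1 (prim w a) (w x).
Proof.
move=> lw ax cw; have xx1 : x < x + 1 by rewrite ltrDl.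
have [d1 d2] := continuous_FTC1_closed xx1 (lbm_integrable a (x + 1) lw) ax cw.
apply: DeriveDef; first exact: d1.
rewrite -derive1E; exact: d2.
Qed.

Let triangle a b := [set z : R * R | a <= z.1 /\ z.1 <= z.2 <= b].

Let measurable_triangle a b :
  measurable (triangle a b : set (measurableTypeR R * measurableTypeR R)).
Proof.
rewrite [X in measurable X](_ : _ = [set z | a <= z.1] `&`
    ([set z | z.1 <= z.2] `&` [set z | z.2 <= b])).
  have m1 := @measurable_fst _ _ (measurableTypeR R) (measurableTypeR R).
  have m2 := @measurable_snd _ _ (measurableTypeR R) (measurableTypeR R).
  have mtrue : measurable [set true] by [].
  apply: measurableI; last apply: measurableI.
  - have := measurable_fun_ler (measurable_cst a) m1 measurableT mtrue.
    by rewrite setTI.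
  - have := measurable_fun_ler m1 m2 measurableT mtrue.
    by rewrite setTI.
  - have := measurable_fun_ler m2 (measurable_cst b) measurableT mtrue.
    by rewrite setTI.
apply/seteqP; split => -[x y]/=; first by move=> [? /andP[]].
by move=> [ax [xy yb]]; split => //; apply/andP.
Qed.

(* [w] is only measurable, so this is Fubini on the triangle a <= x <= y <= b. *)
Lemma Rintegral_by_parts_prim w f f' a b : a <= b -> lbm w ->
  (forall x, is_derive x 1 f (f' x)) -> continuous f' -> f b = 0 ->
  \int[mu]_(x in `[a, b]) (w x * f x) =
  - \int[mu]_(x in `[a, b]) (prim w a x * f' x).
Proof.
move=> ab lw df cf' fb.
pose T := measurableTypeR R.
pose D : set (T * T) := triangle a b.
pose g (z : T * T) := w z.1 * f' z.2.
have lf' := continuous_lbm cf'.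
have lf : lbm f by apply: continuous_lbm => x; exact: is_derive_continuous (df x).
have mD : measurable D by exact: measurable_triangle.
have ig : (mu \x mu)%E.-integrable setT (EFin \o g \_ D).
  rewrite -restrict_EFin; apply: (integrable_mkcond _ mD).1.
  apply: measurable_bounded_integrable => //.
  - apply: (@le_lt_trans _ _ ((mu \x mu)%E (`[a, b] `*` `[a, b]))).
      apply: le_measure; rewrite ?inE//; first exact: measurableX.
      move=> [x y] [/= ax /andP[xy yb]].
      by split; rewrite /= in_itv/= ?ax ?yb/= ?(le_trans xy)// (le_trans ax).
    have fab : (mu `[a, b] < +oo)%E.
      by rewrite lebesgue_measure_itv/=; case: ifP => // _; rewrite -EFinD ltry.
    rewrite product_measure1E//; apply: lte_mul_pinfty => //.
    by rewrite ge0_fin_numE.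
  - apply: measurable_funTS; apply: measurable_funM.
      by apply: measurableT_comp; [exact: lw.1|exact: measurable_fst].
    by apply: measurableT_comp; [exact: lf'.1|exact: measurable_snd].
  - have [M wM] := lw.2 a b; have [N fN] := lf'.2 a b.
    exists (M * N); split; rewrite ?num_real// => K MNK [x y] [/= ax /andP[xy yb]].
    rewrite (le_trans _ (ltW MNK))// normrM ler_pM// ?wM ?fN// ?ax ?yb ?andbT//.
      exact: le_trans yb.
    exact: le_trans xy.
have := Fubini ig.
(* Integrating in y first: the integral of f' over [x, b] is - f x, because f b = 0. The other order
   produces the primitive of [w]. *)
have inner1 x : (\int[mu]_y (g \_ D (x, y))%:E =
    (((fun x => - (w x * f x)) \_ `[a, b]) x)%:E)%E.
  rewrite patchE; case: ifPn => [|xab]; last first.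
    apply: integral0_eq => y _; rewrite patchE ifN//; apply: contra xab.
    rewrite !inE /D/= in_itv/= => -[ax /andP[xy yb]].
    by rewrite ax (le_trans xy).
  rewrite inE/= in_itv/= => /andP[ax xb].
  rewrite (_ : (fun y => _) = (EFin \o (fun y => w x * f' y)) \_ `[x, b]); last first.
    apply/funext => y; rewrite restrict_EFin/= !patchE.
    congr (if _ then _ else _)%:E; apply/idP/idP; rewrite !inE /D/= in_itv/=.
      by move=> -[].
    by move=> xyb; split.
  rewrite -integral_mkcond -EFin_Rintegral//; last first.
    exact/lbm_integrable/lbmZ.
  rewrite RintegralZl//; last exact: lbm_integrable.
  by rewrite (Rintegral_FTC2 xb df cf') fb sub0r mulrN.
have inner2 y : (\int[mu]_x (g \_ D (x, y))%:E =
    (((fun y => prim w a y * f' y) \_ `[a, b]) y)%:E)%E.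
  rewrite patchE; case: ifPn => [|yab]; last first.
    apply: integral0_eq => x _; rewrite patchE ifN//; apply: contra yab.
    rewrite !inE /D/= in_itv/= => -[ax /andP[xy yb]].
    by rewrite yb (le_trans ax).
  rewrite inE/= in_itv/= => /andP[ay yb].
  rewrite (_ : (fun x => _) = (EFin \o (fun x => w x * f' y)) \_ `[a, y]); last first.
    apply/funext => x; rewrite restrict_EFin/= !patchE.
    congr (if _ then _ else _)%:E; apply/idP/idP; rewrite !inE /D/= in_itv/=.
      by move=> -[-> /andP[->]].
    by move=> /andP[ax xy]; split; rewrite //= xy yb.
  rewrite -integral_mkcond -EFin_Rintegral//; last first.
    by apply/lbm_integrable/lbmM => //; exact: lbm_cst.
  by rewrite RintegralZr//; exact: lbm_integrable.
under eq_integral do rewrite /= inner1.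
under [X in _ = X -> _]eq_integral do rewrite /= inner2.
move=> /(congr1 fine); rewrite -!/(Rintegral _ _ _) -!Rintegral_mkcond => <-.
rewrite -mulN1r -RintegralZl//.
  by apply: eq_Rintegral => x _; rewrite mulN1r opprK.
have -> : (fun x => - (w x * f x)) = (fun x => -1 * (w x * f x)).
  by apply/funext => x; rewrite mulN1r.
exact/lbm_integrable/lbmZ/lbmM.
Qed.

End locally_bounded.

(** * Distributional affinity *)

Section du_bois_reymond.
Context {R : realType}.
Implicit Types (u U f t h : R -> R) (a b c l x y e d : R).
Local Notation mu := (@lebesgue_measure R).
Local Notation lbm := locally_bounded_measurable.

Lemma is_derive_shiftB f f' a x : (forall z : R, is_derive z 1 f (f' z)) ->
  is_derive x 1 (fun y => f (y - a)) (f' (x - a)).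
Proof.
move=> df; rewrite -[f' _]mulr1.
apply: (@is_derive1_comp _ f (fun y => y - a)).
have -> : (fun y => y - a) = id - cst a by [].
by apply: is_derive_eq; rewrite subr0.
Qed.

Lemma smooth_class_shiftB f a : smooth_class f -> smooth_class (fun x => f (x - a)).
Proof.
move=> /(smooth_affine 1 (- a)); congr smooth_class.
by apply/funext => x; rewrite mul1r.
Qed.

Lemma continuous_shiftB f a : continuous f -> continuous (fun x => f (x - a)).
Proof.
move=> cf x; apply: (@continuous_comp _ _ _ (fun x => x - a) f); last exact: cf.
by apply: cvgB; [exact: cvg_id|exact: cvg_cst].
Qed.

(** [h (x - c)] is a probability density carried by ]c, c + e[: its mass is the increment of its
    primitive [t], from 0 to 1. *)
Lemma bump_average u t h c l d e p q : lbm u -> 0 <= d ->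
  (forall y, c < y < c + e -> `|u y - l| <= d) ->
  continuous h -> (forall x, is_derive x 1 t (h x)) -> (forall x, 0 <= h x) ->
  (forall x, ~~ (0 < x < e) -> h x = 0) ->
  t (p - c) = 0 -> t (q - c) = 1 -> p <= q ->
  `|\int[mu]_(x in `[p, q]) (u x * h (x - c)) - l| <= d.
Proof.
move=> lu d0 ud ch dt h0 hz tp tq pq.
have chc : continuous (fun x => h (x - c)) by exact: continuous_shiftB.
have lh : lbm (fun x => h (x - c)) by exact: continuous_lbm.
have int1 r : \int[mu]_(x in `[p, q]) (r * h (x - c)) = r.
  rewrite RintegralZl//; last exact: lbm_integrable.
  have -> : \int[mu]_(x in `[p, q]) h (x - c) = t (q - c) - t (p - c).
    apply: (@Rintegral_FTC2 _ (fun x => t (x - c))) => // x.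
    exact: is_derive_shiftB.
  by rewrite tp tq subr0 mulr1.
rewrite -{1}(int1 l) -RintegralB//; last 2 first.
  exact/lbm_integrable/lbmM.
  exact/lbm_integrable/lbmZ.
have lint : lbm (fun x => u x * h (x - c) - l * h (x - c)).
  rewrite (_ : (fun x => _) = (fun x => u x * h (x - c) + (- l) * h (x - c))).
    by apply: lbmD; [exact: lbmM|exact: lbmZ].
  by apply/funext => x; rewrite mulNr.
have il := lbm_integrable p q lint.
rewrite (le_trans (le_normr_Rintegral _ il))// -(int1 d).
apply: le_Rintegral => //.
- exact: integrable_norm il.
- exact/lbm_integrable/lbmZ.
- move=> x _; rewrite -mulrBl normrM (ger0_norm (h0 _)).
  have [xce|/hz->] := boolP (0 < x - c < e); last by rewrite !mulr0.
  rewrite ler_wpM2r// ud//; move/andP: xce => [xc xe].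
  by rewrite -subr_gt0 xc -ltrBlDl.
Qed.

(** Second-order du Bois-Reymond lemma for functions with right limits. The bumps sit immediately to
    the right of their points, so that averages against them see exactly the right limits [U]. Tests
    are confined to the right of [a0], because [prim] is a primitive only beyond its base point. *)
Lemma weakly_affine u U a0 : lbm u ->
  (forall x, a0 < x -> u y @[y --> x^'+] --> U x) ->
  (forall f f' f'' a b, smooth_class f -> (forall x, is_derive x 1 f (f' x)) ->
    (forall x, is_derive x 1 f' (f'' x)) -> a0 < a -> a <= b ->
    (forall x, x <= a -> f x = 0) -> (forall x, b <= x -> f x = 0) ->
    \int[mu]_(x in `[a, b]) (u x * f'' x) = 0) ->
  exists A B, forall x, a0 < x -> U x = A + B * x.
Proof.
move=> lu uU weak.
(* Collinearity of the points of the graph of [U] above a, m and b. *)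
have key a m b : a0 < a -> a < m -> m < b ->
    (b - m) * U a + (m - a) * U b = (b - a) * U m.
  move=> a0a am mb; apply/eqP; rewrite -subr_eq0 -normr_eq0 -[_ == 0]negbK normr_eq0.
  rewrite -normr_gt0; apply/negP => D0; set D := `|_| in D0.
  have ba0 : 0 < 4 * (b - a) by rewrite mulr_gt0// subr_gt0 (lt_trans am).
  (* The absolute weights b - m, m - a and b - a add up to 2 (b - a), so errors of size [d]
     contribute at most D / 2. *)
  pose d : R := D / (4 * (b - a)).
  have d0 : 0 < d by rewrite !divr_gt0.
  have dD : 2 * (b - a) * d < D.
    have -> : 2 * (b - a) * d = D / 2.
      by rewrite /d; field; rewrite gt_eqF// subr_gt0 (lt_trans am).
    by rewrite ltr_pdivrMr// ltr_pMr// ltr1n.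
  have near_d c : a0 < c -> exists2 e, 0 < e & forall y, c < y < c + e -> `|u y - U c| <= d.
    move=> /uU /cvgrPdist_le /(_ _ d0)[e/= e0 ed]; exists e => // y /andP[cy yce].
    rewrite distrC; apply: ed => //=.
    by rewrite distrC gtr0_norm ?subr_gt0// ltrBlDl.
  have a0m := lt_trans a0a am; have a0b := lt_trans a0m mb.
  have [ea ea0 ua] := near_d a a0a.
  have [em em0 um] := near_d m a0m.
  have [eb eb0 ub] := near_d b a0b.
  pose e := Num.min ea (Num.min em eb).
  have e0 : 0 < e by rewrite !lt_min ea0 em0 eb0.
  have [eea [eem eeb]] : e <= ea /\ e <= em /\ e <= eb by rewrite !ge_min !lexx !orbT.
  have {}ua y : a < y < a + e -> `|u y - U a| <= d.
    by move=> /andP[ay ye]; rewrite ua// ay (lt_le_trans ye)// lerD2l.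
  have {}um y : m < y < m + e -> `|u y - U m| <= d.
    by move=> /andP[ay ye]; rewrite um// ay (lt_le_trans ye)// lerD2l.
  have {}ub y : b < y < b + e -> `|u y - U b| <= d.
    by move=> /andP[ay ye]; rewrite ub// ay (lt_le_trans ye)// lerD2l.
  have [T [t [h [k [sT [dT dt] [h0 hz] Tn Tp]]]]] := smooth_ramp e0.
  have ch : continuous h.
    have -> : h = T^`(2).
      apply/funext => x; rewrite derive1nS derive1n1.
      have -> : T^`() = t by apply/funext => y; exact: is_derive1E.
      exact/esym/is_derive1E.
    move=> x; have [g _ dg] := smooth_class_derive (smooth_class_derive1n 2 sT).
    exact: is_derive_continuous (dg x).
  have lh c : lbm (fun x => h (x - c)) by exact/continuous_lbm/continuous_shiftB.
  have be : b <= b + e by rewrite lerDl ltW.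
  have abe : a <= b + e by rewrite (le_trans _ be)// ltW// (lt_trans am).
  have avg c : a <= c -> c <= b -> (forall y, c < y < c + e -> `|u y - U c| <= d) ->
      `|\int[mu]_(x in `[a, b + e]) (u x * h (x - c)) - U c| <= d.
    move=> ac cb uc; apply: (@bump_average u t h c (U c) d e) => //; first exact: ltW.
      by apply: (Tn _ _).2; rewrite subr_le0.
    by apply: (Tp _ _).2; rewrite lerBrDl lerD2r.
  (* The second derivative of this test function is a combination of three
     approximate Dirac masses, and its weights cancel its affine part past b. *)
  pose comb f x := (b - m) * f (x - a) + (m - a) * f (x - b) + (a - b) * f (x - m).
  have dcomb f f' x : (forall z : R, is_derive z 1 f (f' z)) ->
      is_derive x 1 (comb f) (comb f' x).
    move=> df; have dc c : is_derive x 1 (fun y => f (y - c)) (f' (x - c)).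
      exact: is_derive_shiftB.
    exact: is_deriveD.
  have scomb : smooth_class (comb T).
    have sc r c : smooth_class (fun x => r * T (x - c)).
      apply: (@smooth_mul _ (cst r)); first exact: smooth_cst.
      exact: smooth_class_shiftB.
    by apply: smooth_add; [apply: smooth_add|]; exact: sc.
  have Ta x : x <= a -> comb T x = 0.
    move=> xa; rewrite /comb !(Tn _ _).1 ?mulr0 ?addr0// subr_le0//.
    + by rewrite (le_trans xa)// ltW.
    + by rewrite (le_trans xa)// ltW// (lt_trans am).
  have Tb x : b + e <= x -> comb T x = 0.
    move=> bex; rewrite /comb !(Tp _ _).1; first ring.
    + by rewrite lerBrDl (le_trans _ bex)// lerD2r ltW.
    + by rewrite lerBrDl.
    + by rewrite lerBrDl (le_trans _ bex)// lerD2r ltW// (lt_trans am).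
  have := @weak (comb T) (comb t) (comb h) a (b + e) scomb
    (fun x => dcomb _ _ x dT) (fun x => dcomb _ _ x dt) a0a abe Ta Tb.
  rewrite (_ : (fun x => _) = (fun x => (b - m) * (u x * h (x - a)) +
      (m - a) * (u x * h (x - b)) + (a - b) * (u x * h (x - m)))); last first.
    by apply/funext => x; rewrite /comb; ring.
  have lc r c : lbm (fun x => r * (u x * h (x - c))) by exact/lbmZ/lbmM.
  rewrite RintegralD//; last 2 first.
    by apply/lbm_integrable/lbmD; exact: lc.
    by apply/lbm_integrable; exact: lc.
  rewrite RintegralD//; last 2 first.
    by apply/lbm_integrable; exact: lc.
    by apply/lbm_integrable; exact: lc.
  rewrite !RintegralZl//; try by apply/lbm_integrable/lbmM.
  have := avg a (lexx _) (ltW (lt_trans am mb)) ua.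
  have := avg m (ltW am) (ltW mb) um.
  have := avg b (ltW (lt_trans am mb)) (lexx _) ub.
  set Ia := \int[mu]_(x in _) (u x * h (x - a)).
  set Im := \int[mu]_(x in _) (u x * h (x - m)).
  set Ib := \int[mu]_(x in _) (u x * h (x - b)).
  move=> Ibd Imd Iad I0.
  have : D <= 2 * (b - a) * d.
    have -> : D = `|(b - m) * (Ia - U a) + (m - a) * (Ib - U b) + (a - b) * (Im - U m)|.
      by rewrite -normrN /D; congr `|_|; move: I0; lra.
    have nrm r s : 0 <= r -> `|s| <= d -> `|r * s| <= r * d.
      by move=> r0 sd; rewrite normrM ger0_norm// ler_wpM2l.
    have ba : 0 <= b - a by rewrite subr_ge0 ltW// (lt_trans am).
    have -> : 2 * (b - a) * d = (b - m) * d + (m - a) * d + (b - a) * d by ring.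
    rewrite (le_trans (ler_normD _ _))// lerD//.
      rewrite (le_trans (ler_normD _ _))// lerD// nrm// subr_ge0 ltW//.
    by rewrite -normrN -mulNr opprB nrm.
  by move=> /le_lt_trans /(_ dD); rewrite ltxx.
(* The affine function is the chord through a0 + 1 and a0 + 2; every other point is collinear with
   these two. *)
have a01 : a0 < a0 + 1 by rewrite ltrDl.
have a02 : a0 < a0 + 2 by rewrite ltrDl.
have a12 : a0 + 1 < a0 + 2 by rewrite ltrD2l ltr1n.
exists (U (a0 + 1) - (U (a0 + 2) - U (a0 + 1)) * (a0 + 1)), (U (a0 + 2) - U (a0 + 1)).
move=> x a0x; have [x1|x1|->] := ltgtP x (a0 + 1).
- by have := key _ _ _ a0x x1 a12; lra.
- have [x2|x2|->] := ltgtP x (a0 + 2); last by ring.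
  + by have := key _ _ _ a01 x1 x2; lra.
  + by have := key _ _ _ a01 a12 x2; lra.
- by ring.
Qed.

End du_bois_reymond.

(** * Structure of a traveling wave *)

Section monotone.
Context {R : realType}.
Implicit Types (u P : R -> R) (a b x y z l A B : R).
Local Notation mu := (@lebesgue_measure R).

Lemma ae_itv (Q : R -> Prop) a b : (\forall x \ae mu, Q x) -> a < b ->
  exists2 x, a < x < b & Q x.
Proof.
move=> aeQ ab; apply: contrapT => nQ.
have neg : mu.-negligible `]a, b[%classic.
  apply: negligibleS aeQ => x /=; rewrite in_itv/= => axb Qx.
  by apply: nQ; exists x.
have : (mu `]a, b[ = 0)%E by apply: measure_negligible => //; exact: measurable_itv.
rewrite lebesgue_measure_itv/= lte_fin ab -EFinD => -[] /eqP.
by rewrite subr_eq0 gt_eqF.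
Qed.

Lemma nonincreasing_bounds u A B x : nonincreasing_fun u ->
  u y @[y --> -oo] --> A -> u y @[y --> +oo] --> B -> B <= u x <= A.
Proof.
move=> du uA uB; apply/andP; split.
  apply: (cvgr_to_le uB); near=> y; apply: du.
  by near: y; apply: nbhs_pinfty_ge; rewrite num_real.
apply: (cvgr_to_ge uA); near=> y; apply: du.
by near: y; apply: nbhs_ninfty_le; rewrite num_real.
Unshelve. all: by end_near. Qed.

Lemma nonincreasing_right_cvg u x : nonincreasing_fun u ->
  exists l : R, u y @[y --> x^'+] --> l.
Proof.
move=> du; apply/cvg_ex; apply: nonincreasing_at_right_is_cvgr.
  by near=> y => s t _ _; exact: du.
near=> y; exists (u x) => _ /= [z + <-].
by rewrite in_itv/= => /andP[/ltW xz _]; exact: du.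
Unshelve. all: by end_near. Qed.

Lemma nonincreasing_right_le u x l : nonincreasing_fun u ->
  u z @[z --> x^'+] --> l -> l <= u x.
Proof.
move=> du ul; apply: (cvgr_to_le ul); near=> z; apply: du; apply: ltW.
by near: z; exact: nbhs_right_gt.
Unshelve. all: by end_near. Qed.

Lemma nonincreasing_right_ge u x y l : nonincreasing_fun u ->
  u z @[z --> x^'+] --> l -> x < y -> u y <= l.
Proof.
move=> du ul xy; apply: (cvgr_to_ge ul); near=> z; apply: du.
by near: z; exact: nbhs_right_le.
Unshelve. all: by end_near. Qed.

(* A monotone function is determined by its right limits where these vary
   continuously. *)
Lemma nonincreasing_eq_continuous u P a : nonincreasing_fun u ->
  (forall x, a < x -> {for x, continuous P}) ->
  (forall x, a < x -> u y @[y --> x^'+] --> P x) ->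
  forall x, a < x -> u x = P x.
Proof.
move=> du cP uP x ax; apply/eqP; rewrite eq_le.
rewrite (nonincreasing_right_le du (uP x ax)) andbT.
have PxP : P y @[y --> x^'-] --> P x by apply: cvg_at_left_filter; exact: cP.
apply: (cvgr_to_ge PxP); near=> y.
apply: (nonincreasing_right_ge du (uP y _)); first by near: y; exact: nbhs_left_gt.
by near: y; exact: nbhs_left_lt.
Unshelve. all: by end_near. Qed.

Lemma pairing_itv (u g : R -> R) a b : (forall x, ~~ (a <= x <= b) -> g x = 0) ->
  pairing u g = \int[mu]_(x in `[a, b]) (u x * g x).
Proof.
move=> g0; rewrite /pairing [RHS]Rintegral_mkcond; congr (Rintegral mu setT _).
apply/funext => x; rewrite patchE; case: ifPn => //.
by rewrite notin_setE/= in_itv/= => /negP/g0 ->; rewrite mulr0.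
Qed.

Lemma near_eq_continuous (g h : R -> R) x : (\forall y \near x, g y = h y) ->
  {for x, continuous g} -> {for x, continuous h}.
Proof.
move=> gh; rewrite /prop_for /continuous_at -(nbhs_singleton gh).
by apply: cvg_trans; exact: near_eq_cvg.
Qed.

Lemma derive_out (g g' : R -> R) a b x : (forall x : R, is_derive x 1 g (g' x)) ->
  (forall x, ~~ (a <= x <= b) -> g x = 0) -> ~~ (a <= x <= b) -> g' x = 0.
Proof.
move=> dg g0 xab; have oab : open (~` `[a, b]%classic).
  by rewrite openC; exact: interval_closed.
have /nbhs_interior/= : nbhs x (~` `[a, b]%classic).
  by apply: open_nbhs_nbhs; split => //=; rewrite in_itv/=; exact/negP.
move=> /nbhs_singleton nx.
have dg0 : is_derive x 1 g 0.
  apply: (@is_derive_near_eq _ (cst 0)); apply: filterS nx => y /=.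
  by rewrite in_itv/= => /negP/g0 ->.
by rewrite -(is_derive1E (dg x)) (is_derive1E dg0).
Qed.

End monotone.

(** * Free boundary, once-integrated equation and jump relation *)

Section wave.
Context {R : realType}.
Local Notation mu := (@lebesgue_measure R).
Local Notation lbm := locally_bounded_measurable.
Variables (f : R -> R) (pM l c : R) (rho p : R -> R).
Implicit Types (a b x y z : R).
Hypothesis pM_gt0 : 0 < pM.
Hypothesis l01 : 0 <= l < 1.
Hypothesis f_cont : continuous (fun u : R => f (Num.max u 0)).
Hypothesis tw : traveling_wave f pM l c rho p.

Lemma rho_bounds x : l <= rho x <= 1.
Proof. by have [drho _ _ _ [rho1 rhol _ _]] := tw; exact: nonincreasing_bounds. Qed.

Lemma p_bounds x : 0 <= p x <= pM.
Proof. by have [_ dp _ _ [_ _ pM0 p0]] := tw; exact: nonincreasing_bounds. Qed.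

(** If rho x < 1, then rho < 1 on ]x, y[ by monotonicity, and the graph condition gives p = 0 at
    some point there; p being non-increasing, this contradicts p y > 0. *)
Lemma saturated x y : 0 < p y -> x < y -> rho x = 1.
Proof.
have [drho dp _ graph _] := tw; move=> py xy.
have /andP[_] := rho_bounds x; rewrite le_eqVlt => /predU1P[//|rx].
have [z /andP[xz zy]] := ae_itv graph xy.
rewrite /hele_shaw_graph ifT; last exact: le_lt_trans (drho _ _ (ltW xz)) rx.
by move=> -[pz]; move: (dp _ _ (ltW zy)); rewrite leNgt pz py.
Qed.

Lemma interface_exists : exists x0,
  (forall x, x < x0 -> 0 < p x /\ rho x = 1) /\ (forall x, x0 < x -> p x = 0).
Proof.
have [drho dp _ _ [rho1 rhol pM0 p0]] := tw.
have /andP[_ l1] := l01.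
pose S := [set x | 0 < p x].
have S0 : S !=set0.
  have /filter_ex[x px] : \forall x \near -oo, 0 < p x by exact: cvgr_gt pM_gt0.
  by exists x.
(* This is where l < 1 enters: saturation cannot persist up to +oo, so the set where p > 0 is
   bounded above. *)
have /filter_ex[X rX] : \forall x \near +oo, rho x < 1 by exact: cvgr_lt l1.
have Sub : has_ubound S.
  exists X => y py; rewrite leNgt; apply/negP => Xy.
  by move: rX; rewrite (saturated py Xy) ltxx.
exists (sup S); split => x xS.
  have [y py xy] := sup_gt S0 xS.
  by split; [exact: lt_le_trans (dp _ _ (ltW xy))|exact: saturated py xy].
apply/eqP; rewrite eq_le (andP (p_bounds x)).1 andbT leNgt; apply/negP => px.
by move: xS; rewrite ltNge (ub_le_sup Sub px).
Qed.

Definition reaction x := rho x * f (p x).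

Lemma reactionE x : reaction x = rho x * f (Num.max (p x) 0).
Proof. by rewrite /reaction max_l//; case/andP: (p_bounds x). Qed.

Lemma lbm_rho : lbm rho.
Proof. by case: tw => ? *; exact: nonincreasing_lbm. Qed.

Lemma lbm_p : lbm p.
Proof. by case: tw => _ ? *; exact: nonincreasing_lbm. Qed.

Lemma lbm_reaction : lbm reaction.
Proof.
rewrite (_ : reaction = fun x => rho x * ((fun u => f (Num.max u 0)) \o p) x).
  apply: lbmM; [exact: lbm_rho|apply: lbm_comp; [exact: f_cont|exact: lbm_p]].
by apply/funext => x; exact: reactionE.
Qed.

(** The first integral of the wave equation p'' + c rho' + rho f(p) = 0 is p' + flux = constant. *)
Definition flux a x := prim reaction a x + c * rho x.

Lemma lbm_flux a : lbm (flux a).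
Proof.
apply: lbmD; last exact: lbmZ lbm_rho.
by apply: continuous_lbm; exact: prim_continuous lbm_reaction.
Qed.

(** One integration by parts turns the reaction into its primitive against g', where it joins c rho
    to form the flux; a second one moves the primitive of the flux onto g''. No derivative of [rho]
    or [p] is taken. *)
Lemma wave_weakly_affine a : exists A B, forall x, a < x ->
  p x = A + B * x - prim (flux a) a x.
Proof.
have [_ dp weak _ _] := tw.
have V1c := @prim_continuous _ _ a (lbm_flux a).
have pr x : exists k : R, p y @[y --> x^'+] --> k := nonincreasing_right_cvg x dp.
pose P x := sval (cid (pr x)).
have pP x : p y @[y --> x^'+] --> P x := svalP (cid (pr x)).
have [|||A [B AB]] := @weakly_affine _ (fun x => p x + prim (flux a) a x)
    (fun x => P x + prim (flux a) a x) a.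
- by apply: lbmD; [exact: lbm_p|exact: continuous_lbm].
- by move=> x _; apply: cvgD; [exact: pP|apply: cvg_at_right_filter; exact: V1c].
- move=> g g' g'' s t sg dg dg' as_ st ga gb.
  have cg' : continuous g' by move=> x; exact: is_derive_continuous (dg' x).
  have cg : continuous g by move=> x; exact: is_derive_continuous (dg x).
  have cg'' : continuous g''.
    have -> : g'' = g^`(2).
      apply/funext => x; rewrite derive1nS derive1n1.
      have -> : g^`() = g' by apply/funext => y; exact: is_derive1E.
      exact/esym/is_derive1E.
    move=> x; have [h _ dh] := smooth_class_derive (smooth_class_derive1n 2 sg).
    exact: is_derive_continuous (dh x).
  have g1 : g^`() = g' by apply/funext => y; exact: is_derive1E.
  have g2 : g^`(2) = g''.
    by rewrite derive1nS derive1n1 g1; apply/funext => y; exact: is_derive1E.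
  have g0 x : ~~ (s <= x <= t) -> g x = 0.
    by rewrite negb_and -!ltNge => /orP[/ltW/ga|/ltW/gb].
  have g'0 := derive_out dg g0.
  have g''0 := derive_out dg' g'0.
  (* All integrals are taken over [a, t + 1]: the primitives start at [a], and t + 1 lies outside
     [s, t], where [derive_out] gives the vanishing of g' that the second integration by parts
     requires. *)
  have out x : ~~ (a <= x <= t + 1) -> ~~ (s <= x <= t).
    apply: contra => /andP[sx xt]; rewrite (le_trans (ltW as_))//=.
    by rewrite (le_trans xt)// lerDl.
  have tt1 : t < t + 1 by rewrite ltrDl.
  have t1 : ~~ (s <= t + 1 <= t) by rewrite negb_and orbC -ltNge tt1.
  have at1 : a <= t + 1 by rewrite (le_trans (ltW as_))// (le_trans st)// ltW.
  have lg : lbm g by exact: continuous_lbm.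
  have lg' : lbm g' by exact: continuous_lbm.
  have lg'' : lbm g'' by exact: continuous_lbm.
  have lW : lbm (prim reaction a).
    by apply: continuous_lbm; exact: prim_continuous lbm_reaction.
  have lV1 : lbm (prim (flux a) a) by exact: continuous_lbm.
  have gne x : g x != 0 -> s <= x <= t by apply: contraNT => /g0 ->.
  have := weak g (smooth_class_test_function sg gne).
  rewrite g1 g2 (@pairing_itv _ rho g' a (t + 1)); last by move=> x /out/g'0.
  rewrite (@pairing_itv _ p g'' a (t + 1)); last by move=> x /out/g''0.
  rewrite (@pairing_itv _ _ g a (t + 1)); last by move=> x /out/g0.
  rewrite -/reaction (Rintegral_by_parts_prim at1 lbm_reaction dg cg' (g0 _ t1)).
  move=> Hw.
  have Hf := Rintegral_by_parts_prim at1 (lbm_flux a) dg' cg'' (g'0 _ t1).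
  have Hs : \int[mu]_(x in `[a, t + 1]) (flux a x * g' x) =
      \int[mu]_(x in `[a, t + 1]) (prim reaction a x * g' x) +
      c * \int[mu]_(x in `[a, t + 1]) (rho x * g' x).
    rewrite -RintegralZl//; last exact/lbm_integrable/lbmM/lg'/lbm_rho.
    rewrite -RintegralD//; last 2 first.
      exact/lbm_integrable/lbmM.
      exact/lbm_integrable/lbmZ/lbmM/lg'/lbm_rho.
    by apply: eq_Rintegral => x _; rewrite /flux; ring.
  transitivity (pairing (fun x => p x + prim (flux a) a x) g'').
    by rewrite (@pairing_itv _ _ g'' s t).
  rewrite (@pairing_itv _ _ g'' a (t + 1)); last by move=> x /out/g''0.
  rewrite (_ : (fun x => _) = (fun x => p x * g'' x + prim (flux a) a x * g'' x)); last first.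
    by apply/funext => x; rewrite mulrDl.
  rewrite RintegralD//; last 2 first.
    exact/lbm_integrable/lbmM/lg''/lbm_p.
    exact/lbm_integrable/lbmM.
  by move: Hf Hs Hw; lra.
(* So far the identity holds for the right limits of [p]; they vary continuously, hence [p]
   coincides with them. *)
exists A, B; apply: nonincreasing_eq_continuous => //.
- move=> x _; apply: cvgB; last exact: V1c.
  apply: cvgD; first exact: cvg_cst.
  by apply: cvgM; [exact: cvg_cst|exact: cvg_id].
- by move=> x ax; rewrite -AB// addrK; exact: pP.
Qed.

Lemma p_continuous : continuous p.
Proof.
move=> x; have [A [B AB]] := wave_weakly_affine (x - 1).
apply: (@near_eq_continuous _ (fun y => A + B * y - prim (flux (x - 1)) (x - 1) y)).
  near=> y; apply/esym/AB; near: y; apply: lt_nbhsr; rewrite ltrBlDr ltrDl//.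
apply: cvgB; last exact: prim_continuous (lbm_flux _) _.
apply: cvgD; first exact: cvg_cst.
by apply: cvgM; [exact: cvg_cst|exact: cvg_id].
Unshelve. all: by end_near. Qed.

Variable x0 : R.
Hypothesis left_x0 : forall x, x < x0 -> 0 < p x /\ rho x = 1.
Hypothesis right_x0 : forall x, x0 < x -> p x = 0.

Lemma p_right x : x0 <= x -> p x = 0.
Proof.
rewrite le_eqVlt => /predU1P[<-|]; last exact: right_x0.
have px0 : p y @[y --> x0^'+] --> p x0 by apply: cvg_at_right_filter; exact: p_continuous.
apply/eqP; rewrite eq_le (andP (p_bounds x0)).1 andbT.
by apply: (cvgr_to_le px0); near=> y; rewrite right_x0.
Unshelve. all: by end_near. Qed.

Lemma wave_local a : a < x0 -> exists B,
  [/\ forall x, a < x < x0 -> is_derive x 1 p (B - c - prim reaction a x),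
      forall x, a < x < x0 -> is_derive x 1 (prim reaction a) (f (p x)) &
      forall x (r : R), x0 <= x -> rho y @[y --> x^'+] --> r ->
        prim reaction a x + c * r = B].
Proof.
move=> ax0; have [A [B AB]] := wave_weakly_affine a.
have cW := @prim_continuous _ _ a lbm_reaction.
have dW x : a < x -> {for x, continuous reaction} ->
  is_derive x 1 (prim reaction a) (reaction x) by exact: is_derive_prim lbm_reaction.
exists B; split.
- move=> x /andP[ax xx0].
  have fluxE y : y < x0 -> flux a y = prim reaction a y + c.
    by move=> /left_x0[_ r1]; rewrite /flux r1 mulr1.
  have cflux : {for x, continuous (flux a)}.
    apply: (@near_eq_continuous _ (fun y => prim reaction a y + c)).
      by near=> y; apply/esym/fluxE; near: y; exact: lt_nbhsl.
    by apply: cvgD; [exact: cW|exact: cvg_cst].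
  have dV := is_derive_prim (lbm_flux a) ax cflux.
  apply: (@is_derive_near_eq _ (fun y => A + B * y - prim (flux a) a y)).
    by near=> y; apply/esym/AB; near: y; exact: lt_nbhsr.
  have dl := is_derive_affine A B x.
  rewrite (_ : B - c - prim reaction a x = B - flux a x); last first.
    by rewrite fluxE// opprD [- prim _ _ _ - c]addrC addrA.
  exact: is_deriveB dl dV.
- move=> x /andP[ax xx0]; have [_ r1] := left_x0 xx0.
  rewrite (_ : f (p x) = reaction x); last by rewrite /reaction r1 mul1r.
  apply: dW => //.
  apply: (@near_eq_continuous _ ((fun u => f (Num.max u 0)) \o p)).
    near=> y; have [_ ry] : 0 < p y /\ rho y = 1.
      by apply: left_x0; near: y; exact: lt_nbhsl.
    by rewrite reactionE ry mul1r.
  apply: continuous_comp; [exact: p_continuous|exact: f_cont].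
- move=> x r x0x rr.
  have ax := lt_le_trans ax0 x0x.
  (* Beyond x0 the pressure is zero, so the primitive of the flux is affine with slope [B], and [B]
     must be the right limit of the flux. *)
  apply/esym; apply: (prim_right_slope (lbm_flux a) (ltW ax)).
    apply: cvgD; first by apply: cvg_at_right_filter; exact: cW.
    by apply: cvgM => //; exact: cvg_cst.
  move=> y xy; have := AB _ (lt_trans ax xy); have := AB _ ax.
  by rewrite !p_right ?(le_trans x0x (ltW xy))//; lra.
Unshelve. all: by end_near. Qed.

Lemma wave_ode x : x < x0 ->
  is_derive x 1 p (p^`() x) /\ is_derive x 1 p^`() (- f (p x)).
Proof.
move=> xx0; have x1x : x - 1 < x by rewrite ltrBlDr ltrDl.
have [B [dp dW _]] := wave_local (lt_trans x1x xx0).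
have x1xx0 : x - 1 < x < x0 by rewrite x1x.
split; first by rewrite (is_derive1E (dp x x1xx0)); exact: dp.
apply: (@is_derive_near_eq _ (fun y => B - c - prim reaction (x - 1) y)).
  near=> y; rewrite (is_derive1E (dp y _))//; apply/andP; split.
    by near: y; exact: lt_nbhsr.
  by near: y; exact: lt_nbhsl.
have dWx := dW x x1xx0.
have -> : (fun y => B - c - prim reaction (x - 1) y) =
  cst (B - c) - prim reaction (x - 1) by [].
by apply: is_derive_eq; rewrite sub0r.
Unshelve. all: by end_near. Qed.

(** Rankine-Hugoniot relation: the primitive of the reaction is continuous at x0, so the jump of c
    rho alone balances the jump of p'. *)
Lemma wave_jump (r : R) : rho y @[y --> x0^'+] --> r ->
  p^`() y @[y --> x0^'-] --> c * (r - 1).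
Proof.
move=> rr; have x10 : x0 - 1 < x0 by rewrite ltrBlDr ltrDl.
have [B [dp _ /(_ _ _ (lexx _) rr) Br]] := wave_local x10.
have -> : c * (r - 1) = B - c - prim reaction (x0 - 1) x0 by rewrite -Br; ring.
apply: (@cvg_trans _ ((B - c - prim reaction (x0 - 1) y) @[y --> x0^'-])).
  apply: near_eq_cvg; near=> y; rewrite (is_derive1E (dp y _))//; apply/andP; split.
    by near: y; exact: nbhs_left_gt.
  by near: y; exact: nbhs_left_lt.
apply: cvgB; first exact: cvg_cst.
by apply: cvg_at_left_filter; exact: prim_continuous lbm_reaction _.
Unshelve. all: by end_near. Qed.

(** A bootstrap: c rho = B - W beyond x0, so [rho] is continuous there; then the reaction is
    continuous, W is differentiable, and so is [rho]. *)
Lemma wave_tail x : c != 0 -> x0 < x -> is_derive x 1 rho (- (f 0 / c) * rho x).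
Proof.
move=> c0 x0x; have [drho _ _ _ _] := tw.
have x10 : x0 - 1 < x0 by rewrite ltrBlDr ltrDl.
have [B [_ _ Br]] := wave_local x10.
set W := prim reaction (x0 - 1) in Br.
have cW : continuous W by exact: prim_continuous lbm_reaction.
pose P y := (B - W y) * c^-1.
have cP : continuous P.
  move=> y; apply: cvgM; last exact: cvg_cst.
  by apply: cvgB; [exact: cvg_cst|exact: cW].
have rhoP y : x0 < y -> rho y = P y.
  apply: nonincreasing_eq_continuous => // [z _|z x0z]; first exact: cP.
  have [r rr] := nonincreasing_right_cvg z drho.
  by rewrite /P -(Br _ _ (ltW x0z) rr) addrAC subrr add0r mulrAC mulfV// mul1r.
have near_x0 : \forall y \near x, x0 < y by exact: lt_nbhsr.
have crho : {for x, continuous rho}.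
  apply: (@near_eq_continuous _ P); last exact: cP.
  by apply: filterS near_x0 => y /rhoP ->.
have creaction : {for x, continuous reaction}.
  apply: (@near_eq_continuous _ (fun y => rho y * f 0)).
    by apply: filterS near_x0 => y x0y; rewrite /reaction right_x0.
  by apply: cvgM; [exact: crho|exact: cvg_cst].
have dW : is_derive x 1 W (reaction x).
  exact: is_derive_prim lbm_reaction (lt_trans x10 x0x) creaction.
apply: (@is_derive_near_eq _ P).
  by apply: filterS near_x0 => y /rhoP ->.
have -> : P = (cst B - W) * cst (c^-1) by [].
apply: is_derive_eq; rewrite /reaction right_x0// /GRing.scale/=.
by rewrite mulr0 add0r sub0r; ring.
Qed.

(** At zero speed the first integral makes the primitive of the reaction constant beyond x0, so the
    right limits of rho f 0 vanish. *)
Lemma wave_tail0 x : c = 0 -> f 0 != 0 -> x0 < x -> rho x = 0.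
Proof.
move=> c0 f0 x0x; have [drho _ _ _ _] := tw.
have x10 : x0 - 1 < x0 by rewrite ltrBlDr ltrDl.
have [B [_ _ Br]] := wave_local x10.
have /andP[l0 _] := l01; have /andP[lrho _] := rho_bounds x.
(* A point strictly between x0 and x: the right limit of [rho] at [z] bounds rho x from above. *)
pose z := (x0 + x) / 2.
have [x0z zx] := midf_lt x0x; rewrite -/z in x0z zx.
have WB y : x0 <= y -> prim reaction (x0 - 1) y = B.
  move=> x0y; have [r rr] := nonincreasing_right_cvg y drho.
  by rewrite -(Br _ _ x0y rr) c0 mul0r addr0.
have [r rr] := nonincreasing_right_cvg z drho.
have r0 : 0 = r * f 0.
  apply: (prim_right_slope lbm_reaction (ltW (lt_trans x10 x0z))).
    apply: (@cvg_trans _ ((rho y * f 0) @[y --> z^'+])).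
      apply: near_eq_cvg; near=> y; rewrite /reaction right_x0//.
      by rewrite (lt_trans x0z)//; near: y; exact: nbhs_right_gt.
    by apply: cvgM => //; exact: cvg_cst.
  by move=> y zy; rewrite !WB ?subrr ?mul0r// ltW// (lt_trans x0z).
have {}r0 : r = 0 by move/esym/eqP: r0; rewrite mulf_eq0 (negbTE f0) orbF => /eqP.
apply/eqP; rewrite eq_le (le_trans l0 lrho) andbT -r0.
exact: (nonincreasing_right_ge drho rr zx).
Unshelve. all: by end_near. Qed.

End wave.

(** * Phase plane and uniqueness of the front *)

Section phase_plane.
Context {R : realType}.
Implicit Types (a b u v x y z : R) (g h : R -> R).

Lemma nonincreasing_derive_le0 g x (l : R) :
  nonincreasing_fun g -> is_derive x 1 g l -> l <= 0.
Proof.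
move=> dg /is_derive1_caratheodory[k [gk ck <-]].
have kx : k y @[y --> x^'+] --> k x by exact: cvg_at_right_filter.
apply: (cvgr_to_le kx); near=> y.
have xy : x < y by near: y; exact: nbhs_right_gt.
have : k y * (y - x) <= 0 by rewrite -gk subr_le0 dg// ltW.
by rewrite pmulr_lle0// subr_gt0.
Unshelve. all: by end_near. Qed.

Lemma left_eq_continuous g h x : {for x, continuous g} -> {for x, continuous h} ->
  (forall y, y < x -> g y = h y) -> g x = h x.
Proof.
move=> cg ch gh.
have gx : g y @[y --> x^'-] --> g x by exact: cvg_at_left_filter.
have hx : h y @[y --> x^'-] --> h x by exact: cvg_at_left_filter.
have gh0 : g y - h y @[y --> x^'-] --> g x - h x by exact: cvgB.
apply/eqP; rewrite -subr_eq0 eq_le; apply/andP; split.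
  by apply: (cvgr_to_le gh0); near=> y; rewrite gh ?subrr.
by apply: (cvgr_to_ge gh0); near=> y; rewrite gh ?subrr.
Unshelve. all: by end_near. Qed.

Lemma is_derive_sqr g x (l : R) : is_derive x 1 g l ->
  is_derive x 1 (fun y => g y ^+ 2) (2 * g x * l).
Proof.
by move=> dg; have := is_deriveX 2 dg; rewrite /GRing.scale/= expr1.
Qed.

Variables (f F : R -> R) (pM : R).
Hypothesis pM_gt0 : 0 < pM.
Hypothesis dF : forall u : R, is_derive u 1 F (f (Num.max u 0)).

Definition gap u := F pM - F u.

Lemma is_derive_gap u : 0 <= u -> is_derive u 1 gap (- f u).
Proof.
move=> u0; have := is_deriveB (is_derive_cst (F pM) u 1) (dF u).
by rewrite sub0r max_l.
Qed.

Lemma gap_continuous u : 0 <= u -> {for u, continuous gap}.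
Proof. by move=> /is_derive_gap; exact: is_derive_continuous. Qed.

(** No limit of [q] at -oo is assumed; that the constant energy [e] is zero comes from excluding
    both signs, using only that gap (p y) tends to 0 and that [p] is bounded. *)
Lemma orbit_energy (p q : R -> R) x0 :
  (forall x, x < x0 -> is_derive x 1 p (q x) /\ is_derive x 1 q (- f (p x))) ->
  nonincreasing_fun p -> (forall x, 0 <= p x <= pM) -> p x @[x --> -oo] --> pM ->
  forall x, x < x0 -> q x <= 0 /\ q x ^+ 2 = 2 * gap (p x).
Proof.
move=> dpq dp pb pcvg.
have q_le0 x : x < x0 -> q x <= 0.
  by move=> /dpq[+ _]; exact: nonincreasing_derive_le0.
pose E x := q x ^+ 2 - 2 * gap (p x).
have itvI : is_interval [set x | x < x0].
  by move=> a b _ bx z /andP[_ /le_lt_trans]; exact.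
have dE x : x < x0 -> is_derive x 1 E 0.
  move=> xx0; have [dpx dqx] := dpq x xx0; have /andP[px0 _] := pb x.
  have d1 := is_derive_sqr dqx.
  have d2 := is_deriveZ 2 (is_derive1_comp (is_derive_gap px0) dpx).
  have := is_deriveB d1 d2; rewrite /GRing.scale/=.
  by rewrite (_ : 2 * q x * - f (p x) - _ = 0)//; ring.
have Ecst x y : x < x0 -> y < x0 -> E x = E y.
  by move=> xx yy; apply: (derive0_cst_itv itvI).
have E_eq0 x : x < x0 -> E x = 0; last first.
  move=> x xx0; split; first exact: q_le0.
  by have /eqP := E_eq0 x xx0; rewrite subr_eq0 => /eqP.
move=> xx0; set e := E x.
have gap0 : 2 * gap (p y) @[y --> -oo] --> 0.
  rewrite -(mulr0 2) (_ : 0 = gap pM); last by rewrite /gap subrr.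
  apply: cvgM; first exact: cvg_cst.
  by apply: continuous_cvg => //; exact/gap_continuous/ltW.
have qE y : y < x0 -> q y ^+ 2 = e + 2 * gap (p y).
  by move=> yx0; rewrite /e (Ecst x y)// subrK.
have [e0|e0|//] := ltgtP e 0.
  (* A negative energy would make the square q^2 = e + 2 gap p negative near -oo. *)
  have [y [yx0]] : exists y, y < x0 /\ 2 * gap (p y) < - e.
    have /filter_ex[y [yx0 ye]] : \forall y \near -oo, y < x0 /\ 2 * gap (p y) < - e.
      apply: filterI; first by apply: nbhs_ninfty_lt; rewrite num_real.
      by apply: cvgr_lt gap0 _ _; rewrite oppr_gt0.
    by exists y.
  by move=> ye; exfalso; have := sqr_ge0 (q y); rewrite qE//; lra.
(* A slope bounded away from 0 near -oo would make p unbounded. *)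
have e20 : 0 < e / 2 by rewrite divr_gt0.
pose s := Num.sqrt (e / 2).
have s0 : 0 < s by rewrite sqrtr_gt0.
have [X [XX0 Xs]] : exists X, X < x0 /\ forall y, y <= X -> q y <= - s.
  have [M [_ HM]] : \forall y \near -oo, - (e / 2) < 2 * gap (p y).
    by apply: cvgr_gt gap0 _ _; rewrite oppr_lt0.
  exists (Num.min (x0 - 1) (M - 1)).
  have X1 : Num.min (x0 - 1) (M - 1) <= x0 - 1 by rewrite ge_min lexx.
  have X2 : Num.min (x0 - 1) (M - 1) <= M - 1 by rewrite ge_min lexx orbT.
  have x01 : x0 - 1 < x0 by rewrite ltrBlDr ltrDl.
  split; first exact: le_lt_trans x01.
  move=> y yX; have yx0 : y < x0 by rewrite (le_lt_trans yX)// (le_lt_trans X1).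
  have yM : y < M.
    by rewrite (le_lt_trans yX)// (le_lt_trans X2)// ltrBlDr ltrDl.
  rewrite lerNr /s -(ger0_norm (_ : 0 <= - q y)) ?oppr_ge0 ?q_le0//.
  rewrite -sqrtr_sqr sqrrN ler_sqrt ?sqr_ge0// qE//.
  by have := HM _ yM; lra.
(* Over this length a slope of at most -s lowers [p] by pM + 1, more than its range [0, pM]
   allows. *)
pose y := X - (pM + 1) / s.
have yX : y < X by rewrite ltrBlDr ltrDl divr_gt0// addr_gt0.
have [z /andP[yz zX] pXy] := mvt_itv itvI (fun z zx => (dpq z zx).1) (lt_trans yX XX0) XX0 yX.
have : (pM + 1) <= p y - p X.
  rewrite -opprB pXy -mulNr (_ : X - y = (pM + 1) / s); last by rewrite /y; ring.
  rewrite mulrC -mulrA ler_pMr ?addr_gt0// mulrC ler_pdivlMr// mul1r lerNr.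
  exact: Xs (ltW zX).
have /andP[_ py] := pb y; have /andP[pX _] := pb X.
by lra.
Unshelve. all: by end_near. Qed.

(** The pressure profile by itself: speed and density do not appear, so one profile serves every
    speed and every tail. *)
Definition front (p : R -> R) x0 :=
  [/\ forall x, x < x0 -> 0 < p x < pM,
      forall x, x0 <= x -> p x = 0,
      continuous p &
      forall x, x < x0 -> is_derive x 1 p (- Num.sqrt (2 * gap (p x)))].

(** The Lipschitz bound at the zero pM of [f] gives |f v| <= K (pM - v), which is integrated from u
    to pM. *)
Lemma gap_le_quadratic K u : (forall u v, 0 <= u -> 0 <= v -> `|f u - f v| <= K * `|u - v|) ->
  f pM = 0 -> 0 <= u <= pM -> 2 * gap u <= K * (pM - u) ^+ 2.
Proof.
move=> flip fpM /andP[u0 upM].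
have itvI : is_interval [set v | 0 <= v <= pM].
  move=> a b /andP[a0 _] /andP[_ bM] z /andP[az zb] /=.
  by rewrite (le_trans a0)// (le_trans zb).
rewrite -subr_le0.
have -> : 0 = 2 * gap pM - K * (pM - pM) ^+ 2.
  by rewrite /gap !subrr expr0n/= !mulr0 subrr.
apply: (@derive_ge0_le_itv _ _ (fun v => 2 * gap v - K * (pM - v) ^+ 2)
  (fun v => 2 * (- f v) - K * (2 * (pM - v) * (- 1))) _ _ itvI) => //=.
- move=> v /andP[v0 vM].
  have d1 := is_deriveZ 2 (is_derive_gap v0).
  have d2 := is_deriveB (is_derive_cst pM v 1) (is_derive_id v 1).
  have := is_deriveB d1 (is_deriveZ K (is_derive_sqr d2)).
  by rewrite sub0r.
- move=> v /andP[v0 vM].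
  have := flip v pM v0 (ltW pM_gt0); rewrite fpM subr0 distrC.
  rewrite (ger0_norm (_ : 0 <= pM - v)) ?subr_ge0// => /ler_normlP[_].
  by lra.
- by rewrite u0.
- by rewrite ltW//= lexx.
Qed.

(* Gronwall: the orbit cannot leave the equilibrium pM in finite time because
   sqrt (2 gap u) <= sqrt K (pM - u). *)
Lemma orbit_lt (p : R -> R) K x0 :
  (forall u v, 0 <= u -> 0 <= v -> `|f u - f v| <= K * `|u - v|) -> f pM = 0 ->
  continuous p -> (forall x, 0 <= p x <= pM) -> p x0 = 0 ->
  (forall x, x < x0 -> is_derive x 1 p (- Num.sqrt (2 * gap (p x)))) ->
  forall x, x < x0 -> p x < pM.
Proof.
move=> flip fpM cp pb px0 dp x xx0; have /andP[_ pxM] := pb x.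
rewrite lt_neqAle pxM andbT; apply/eqP => px.
have itvI : is_interval [set x | x < x0].
  by move=> a b _ bx z /andP[_ /le_lt_trans]; exact.
pose k := Num.sqrt K.
have K0 : 0 <= K.
  have := flip pM 0 (ltW pM_gt0) (lexx 0); rewrite subr0 (gtr0_norm pM_gt0).
  by move=> /(le_trans (normr_ge0 _)); rewrite pmulr_lge0.
(* Since p' >= k (p - pM), [m] is nondecreasing; as it is also nonpositive, once zero it stays zero
   up to x0, where p = 0 is a contradiction. *)
pose m y := (p y - pM) * expR (- (k * y)).
have dm y : y < x0 -> is_derive y 1 m
    ((- Num.sqrt (2 * gap (p y)) - k * (p y - pM)) * expR (- (k * y))).
  move=> yx0.
  have d1 := is_deriveB (dp y yx0) (is_derive_cst pM y 1).
  have d2 : is_derive y 1 (fun y => - (k * y)) (- k).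
    by have := is_deriveN (is_deriveZ k (is_derive_id y 1)); rewrite /GRing.scale/= mulr1.
  have d3 := @is_derive1_comp _ expR (fun y => - (k * y)) y _ _ (is_derive_expR _) d2.
  have -> : (- Num.sqrt (2 * gap (p y)) - k * (p y - pM)) * expR (- (k * y)) =
      (p y - pM) * (expR (- (k * y)) * - k) +
      expR (- (k * y)) * (- Num.sqrt (2 * gap (p y)) - 0) by ring.
  exact: is_deriveM d1 d3.
have m0 y : x <= y -> y < x0 -> p y = pM.
  move=> xy yx0; have /andP[_ pyM] := pb y; apply/eqP; rewrite eq_le pyM/=.
  have : m x <= m y.
    apply: (derive_ge0_le_itv itvI dm) => // z zx0; apply: mulr_ge0; last exact: expR_ge0.
    have := gap_le_quadratic flip fpM (pb z).
    rewrite -ler_sqrt; last by rewrite mulr_ge0// sqr_ge0.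
    rewrite (@sqrtrM _ K _ K0) sqrtr_sqr ger0_norm ?subr_ge0 ?(andP (pb z)).2// -/k.
    by lra.
  by rewrite /m px subrr mul0r pmulr_lge0 ?expR_gt0// subr_ge0.
have px0cvg : p y @[y --> x0^'-] --> p x0 by exact/cvg_at_left_filter/cp.
have : pM <= p x0; last by rewrite px0 leNgt pM_gt0.
apply: (cvgr_to_ge px0cvg); near=> y; rewrite m0//.
by near: y; exact: nbhs_left_ge.
Unshelve. all: by end_near. Qed.

Hypothesis gap_gt0 : forall u, 0 < u < pM -> 0 < gap u.

Lemma slowness_exists : exists Y, forall u, 0 < u < pM ->
  is_derive u 1 Y (Num.sqrt (2 * gap u))^-1.
Proof.
have [||u|Y dY] := @antiderivative_itv _ `]0, pM[%classic
  (fun u => (Num.sqrt (2 * gap u))^-1).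
- exact: interval_open.
- exact: interval_is_interval.
- rewrite inE/= in_itv/= => /andP[u0 uM].
  apply: cvgV; first by rewrite gt_eqF// sqrtr_gt0 mulr_gt0// gap_gt0// u0.
  apply: continuous_comp; last exact: sqrt_continuous.
  by apply: cvgM; [exact: cvg_cst|exact/gap_continuous/ltW].
- by exists Y => u u0M; apply: dY; rewrite /= in_itv.
Qed.

Lemma front_unique p1 p2 x1 x2 : front p1 x1 -> front p2 x2 ->
  forall x, p2 x = p1 (x + (x1 - x2)).
Proof.
have [Y dY] := slowness_exists.
have itvM : is_interval [set u | 0 < u < pM].
  move=> a b /andP[a0 _] /andP[_ bM] z /andP[az zb] /=.
  by rewrite (lt_le_trans a0)// (le_lt_trans zb).
have Yinj u v : 0 < u < pM -> 0 < v < pM -> Y u = Y v -> u = v.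
  move=> uM vM; have Ylt := derive_gt0_lt_itv itvM dY.
  have s0 z : 0 < z < pM -> 0 < (Num.sqrt (2 * gap z))^-1.
    by move=> zM; rewrite invr_gt0 sqrtr_gt0 mulr_gt0// gap_gt0.
  have [uv|vu|//] := ltgtP u v => Yuv.
    by have := Ylt _ _ s0 uM vM uv; rewrite Yuv ltxx.
  by have := Ylt _ _ s0 vM uM vu; rewrite Yuv ltxx.
have time p x0 : front p x0 -> exists k, forall x, x < x0 -> Y (p x) = k - x.
  move=> [pb _ _ dp]; exists (Y (p (x0 - 1)) + (x0 - 1)) => x xx0.
  have itvI : is_interval [set x | x < x0].
    by move=> a b _ bx z /andP[_ /le_lt_trans]; exact.
  have x01 : x0 - 1 < x0 by rewrite ltrBlDr ltrDl.
  apply/eqP; rewrite eq_sym subr_eq; apply/eqP.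
  apply: (@derive0_cst_itv _ _ (fun x => Y (p x) + x) _ _ itvI) => // z zx0.
  have d1 := is_derive1_comp (dY _ (pb z zx0)) (dp z zx0).
  have := is_deriveD d1 (is_derive_id z 1).
  rewrite mulrN mulVf ?addNr// gt_eqF// sqrtr_gt0 mulr_gt0// gap_gt0//.
  exact: pb.
have shifted g a : continuous g -> continuous (fun x : R => g (x + a)).
  move=> cg x; have := @continuous_shiftB R g (- a) cg.
  by under [X in continuous X]eq_fun do rewrite opprK; exact.
(* Both profiles solve Y (p x) + x = constant, so the one translated so that the
   constants agree cannot vanish before the other. *)
have not_before p q x0 y0 (s : R) : front p x0 -> front q y0 ->
    (forall x, x < x0 -> x < y0 - s -> p x = q (x + s)) -> ~ y0 - s < x0.
  move=> [pb _ cp _] [_ q0 cq _] pq yx.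
  have /andP[+ _] := pb _ yx.
  rewrite (@left_eq_continuous p (fun x => q (x + s)) (y0 - s)) ?subrK ?q0 ?ltxx//.
  - exact: cp.
  - exact: shifted.
  - by move=> y yy; apply: pq => //; exact: lt_trans yx.
move=> fp1 fp2; have [k1 Yk1] := time _ _ fp1; have [k2 Yk2] := time _ _ fp2.
have [pb1 pr1 _ _] := fp1; have [pb2 pr2 _ _] := fp2.
pose h := k1 - k2.
have p21 x : x < x2 -> x < x1 - h -> p2 x = p1 (x + h).
  move=> xx2 xx1; have xhx1 : x + h < x1 by rewrite -ltrBrDr.
  apply: Yinj; [exact: pb2|exact: pb1|].
  by rewrite Yk1// Yk2// /h; ring.
have p12 x : x < x1 -> x < x2 - (- h) -> p1 x = p2 (x + (- h)).
  move=> xx1; rewrite -ltrBlDr opprK => xx2.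
  by rewrite p21 ?subrK// ltrD2r.
have x12 : x1 - h = x2.
  apply/eqP; rewrite eq_le !leNgt; apply/andP; split; apply/negP.
    move=> x2h; apply: (not_before _ _ _ _ (- h) fp1 fp2 p12).
    by rewrite opprK -ltrBrDr.
  exact: not_before fp2 fp1 p21.
move=> x; have -> : x1 - x2 = h by rewrite -x12; ring.
have [xx2|x2x] := ltP x x2; first by apply: p21; rewrite ?x12.
by rewrite pr2// pr1// -lerBlDr x12.
Qed.

End phase_plane.

(** * Existence of the front *)

Section front_existence.
Context {R : realType}.
Implicit Types (u v x y z t : R).
Variables (f F : R -> R) (pM : R).
Local Notation G := (gap F pM).
Hypothesis pM_gt0 : 0 < pM.
Hypothesis dF : forall u : R, is_derive u 1 F (f (Num.max u 0)).
Hypothesis gap_gt0 : forall u, 0 < u < pM -> 0 < G u.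

Let itvM : is_interval [set u | 0 < u < pM].
Proof.
move=> a b /andP[a0 _] /andP[_ bM] z /andP[az zb] /=.
by rewrite (lt_le_trans a0)// (le_lt_trans zb).
Qed.

Let slowness_gt0 u : 0 < u < pM -> 0 < (Num.sqrt (2 * G u))^-1.
Proof. by move=> uM; rewrite invr_gt0 sqrtr_gt0 mulr_gt0// gap_gt0. Qed.

(** [Z u] is the distance over which the profile falls from u to 0, so the profile is the inverse of
    - Z on the negative half-line. The last two hypotheses make [Z] onto ]0, +oo[: the front ends at
    a finite point and extends to -oo. *)
Lemma front_of_time (Z : R -> R) :
  (forall u, 0 < u < pM -> is_derive u 1 Z (Num.sqrt (2 * G u))^-1) ->
  (forall u, 0 < u < pM -> 0 < Z u) ->
  (forall t, 0 < t -> exists2 u : R, 0 < u < pM & Z u < t) ->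
  (forall t, exists2 u : R, 0 < u < pM & t < Z u) ->
  exists p, [/\ front F pM p 0, nonincreasing_fun p & p x @[x --> -oo] --> pM].
Proof.
move=> dZ Z0 Zlow Zhigh.
have Zlt u v : 0 < u < pM -> 0 < v < pM -> u < v -> Z u < Z v.
  exact: (derive_gt0_lt_itv itvM dZ slowness_gt0).
have Zle u v : 0 < u < pM -> 0 < v < pM -> u <= v -> Z u <= Z v.
  by move=> uM vM; rewrite le_eqVlt => /predU1P[->//|/(Zlt _ _ uM vM)/ltW].
have Zltr u v : 0 < u < pM -> 0 < v < pM -> Z u < Z v -> u < v.
  by move=> uM vM; rewrite !ltNge; apply: contra; exact: Zle.
have Zsurj t : 0 < t -> exists u, 0 < u < pM /\ Z u = t.
  move=> t0; have [u uM ut] := Zlow t t0; have [v vM tv] := Zhigh t.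
  have uv : u <= v by apply/ltW/Zltr => //; exact: lt_trans tv.
  have Izv z : u <= z <= v -> 0 < z < pM by exact: itvM.
  have [||z] := @IVT _ Z u v t uv.
  - apply: continuous_in_subspaceT => z; rewrite inE/= in_itv/= => /Izv zM.
    exact: is_derive_continuous (dZ z zM).
  - rewrite min_l ?max_r; [|by apply/ltW/(lt_trans ut)..].
    by rewrite !ltW.
  - by rewrite in_itv/= => /Izv zM Zz; exists z.
(* The implication stands under the existential so that choice yields a total function; the witness
   0 for x >= 0 is a dummy. *)
have inv x : exists u, x < 0 -> 0 < u < pM /\ Z u = - x.
  have [x0|x0] := ltP x 0; last by exists 0.
  have nx0 : 0 < - x by rewrite oppr_gt0.
  by have [u uM] := Zsurj _ nx0; exists u.
pose g x := sval (cid (inv x)).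
have gP x : x < 0 -> 0 < g x < pM /\ Z (g x) = - x := svalP (cid (inv x)).
pose p x := if x < 0 then g x else 0.
have pneg x : x < 0 -> 0 < p x < pM /\ Z (p x) = - x.
  by move=> x0; rewrite /p x0; exact: gP.
have ppos x : 0 <= x -> p x = 0 by rewrite /p leNgt => /negbTE ->.
have dp : nonincreasing_fun p.
  move=> x y xy; have [y0|y0] := ltP y 0.
    have [yM Zy] := pneg y y0; have [xM Zx] := pneg x (le_lt_trans xy y0).
    move: xy; rewrite le_eqVlt => /predU1P[->//|xy].
    by apply/ltW/Zltr => //; rewrite Zx Zy ltrN2.
  rewrite (ppos y y0); have [x0|x0] := ltP x 0; last by rewrite ppos.
  by have [/andP[/ltW]] := pneg x x0.
have Zinv u : 0 < u < pM -> p (- Z u) = u.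
  move=> uM; have [vM Zv] : 0 < p (- Z u) < pM /\ Z (p (- Z u)) = - - Z u.
    by apply: pneg; rewrite oppr_lt0 Z0.
  move: Zv; rewrite opprK => Zv.
  have [uv|vu|//] := ltgtP (p (- Z u)) u.
    by have := Zlt _ _ vM uM uv; rewrite Zv ltxx.
  by have := Zlt _ _ uM vM vu; rewrite Zv ltxx.
have derp x : x < 0 -> is_derive x 1 p (- Num.sqrt (2 * G (p x))).
  move=> x0; have [uM Zu] := pneg x x0; set u := p x in uM Zu *.
  have [u0 uM'] := andP uM.
  have nearM : \forall v \near u, 0 < v < pM.
    by near=> v; apply/andP; split; near: v; [exact: lt_nbhsr|exact: lt_nbhsl].
  have dNZ v : 0 < v < pM -> is_derive v 1 (fun u => - Z u) (- (Num.sqrt (2 * G v))^-1).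
    by move=> vM; exact: is_deriveN (dZ v vM).
  have := @is_derive_inverse _ (fun u => - Z u) p (- (Num.sqrt (2 * G u))^-1) u.
  rewrite invrN invrK Zu opprK; apply.
  - by apply: filterS nearM => v /Zinv.
  - by apply: filterS nearM => v /dNZ; exact: is_derive_continuous.
  - exact: dNZ.
  - by rewrite oppr_eq0 gt_eqF// slowness_gt0.
have cp0 : {for 0, continuous p}.
  apply/cvgrPdist_lt => e e0; rewrite ppos//.
  pose v := Num.min (e / 2) (pM / 2).
  have vM : 0 < v < pM.
    rewrite lt_min !divr_gt0//=; apply: (@le_lt_trans _ _ (pM / 2)).
      by rewrite ge_min lexx orbT.
    by rewrite ltr_pdivrMr// ltr_pMr// ltr1n.
  have ve : v < e.
    apply: (@le_lt_trans _ _ (e / 2)); first by rewrite ge_min lexx.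
    by rewrite ltr_pdivrMr// ltr_pMr// ltr1n.
  near=> y; rewrite sub0r normrN; have [y0|y0] := ltP y 0; last by rewrite ppos// normr0.
  have [yM Zy] := pneg y y0; rewrite gtr0_norm; last by case/andP: yM.
  apply: lt_trans ve; apply: Zltr => //; rewrite Zy ltrNl.
  by near: y; apply: lt_nbhsr; rewrite oppr_lt0 Z0.
exists p; split => //.
- split; [by move=> x /pneg[]|exact: ppos| |exact: derp].
  move=> x; have [x0|x0|->//] := ltgtP x 0.
    exact: is_derive_continuous (derp x x0).
  apply: (@near_eq_continuous _ (cst 0)); last exact: cvg_cst.
  by near=> y; rewrite ppos//; apply: ltW; near: y; exact: lt_nbhsr.
- apply/cvgrPdist_lt => e e0; pose v := pM - Num.min (e / 2) (pM / 2).
  have vM : 0 < v < pM.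
    rewrite /v subr_gt0 ltrBlDr ltrDl lt_min !divr_gt0//= andbT.
    apply: (@le_lt_trans _ _ (pM / 2)); first by rewrite ge_min lexx orbT.
    by rewrite ltr_pdivrMr// ltr_pMr// ltr1n.
  have ve : pM - v < e.
    rewrite /v subKr; apply: (@le_lt_trans _ _ (e / 2)); first by rewrite ge_min lexx.
    by rewrite ltr_pdivrMr// ltr_pMr// ltr1n.
  near=> y; have yv : y < - Z v by near: y; apply: nbhs_ninfty_lt; rewrite num_real.
  have y0 : y < 0 by rewrite (lt_trans yv)// oppr_lt0 Z0.
  have [yM Zy] := pneg y y0; have /andP[_ pyM] := yM.
  rewrite gtr0_norm ?subr_gt0//; apply: lt_trans ve; rewrite ltrD2l ltrN2.
  by apply: Zltr => //; rewrite Zy ltrNr.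
Unshelve. all: by end_near. Qed.

(* Near 0 the linear bound makes (2 G)^(-1/2) integrable, so p vanishes after a
   finite time; near pM the quadratic bound makes it diverge logarithmically. *)
Lemma front_exists (K k d : R) : 0 < K -> 0 < k -> 0 < d < pM ->
  (forall u, 0 <= u <= pM -> 2 * G u <= K * (pM - u) ^+ 2) ->
  (forall u, 0 < u <= d -> k * u <= G u) ->
  exists p, [/\ front F pM p 0, nonincreasing_fun p & p x @[x --> -oo] --> pM].
Proof.
move=> K0 k0 dM GK Gk; have /andP[d0 dpM] := dM.
have [Y dY] := slowness_exists dF gap_gt0.
have Ylt u v : 0 < u < pM -> 0 < v < pM -> u < v -> Y u < Y v.
  exact: (derive_gt0_lt_itv itvM dY slowness_gt0).
pose S := Y @` [set u | 0 < u < pM].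
have [m mS] : exists m : R, lbound S m.
  (* Chosen so that the derivative of C sqrt v is (2 k v)^(-1/2), which dominates the slowness on
     ]0, d]. *)
  pose C := 2 / Num.sqrt (2 * k).
  have C0 : 0 <= C by rewrite divr_ge0// sqrtr_ge0.
  have mYd : Y d - C * Num.sqrt d <= Y d by rewrite gerBl mulr_ge0// sqrtr_ge0.
  exists (Y d - C * Num.sqrt d) => _ [u uM <-].
  have [du|ud] := leP d u.
    rewrite (le_trans mYd)//; move: du; rewrite le_eqVlt => /predU1P[->//|du].
    exact/ltW/Ylt.
  have itvd : is_interval [set u | 0 < u <= d].
    move=> a b /andP[a0 _] /andP[_ bM] z /andP[az zb] /=.
    by rewrite (lt_le_trans a0)// (le_trans zb).
  have : C * Num.sqrt u - Y u <= C * Num.sqrt d - Y d.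
    apply: (@derive_ge0_le_itv _ _ (fun v => C * Num.sqrt v - Y v)
      (fun v => C * (2 * Num.sqrt v)^-1 - (Num.sqrt (2 * G v))^-1) _ _ itvd).
    - move=> v /andP[v0 vd].
      have d1 := is_deriveZ C (is_derive1_sqrt v0).
      have vM : 0 < v < pM by rewrite v0 (le_lt_trans vd).
      exact: is_deriveB d1 (dY v vM).
    - move=> v /andP[v0 vd].
      have vM : 0 < v < pM by rewrite v0 (le_lt_trans vd).
      have -> : C * (2 * Num.sqrt v)^-1 = (Num.sqrt (2 * (k * v)))^-1.
        rewrite mulrA sqrtrM ?mulr_ge0// ?ltW// /C.
        by field; rewrite !gt_eqF ?sqrtr_gt0 ?mulr_gt0.
      rewrite subr_ge0 lef_pV2 ?posrE ?sqrtr_gt0 ?mulr_gt0 ?gap_gt0//.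
      rewrite ler_sqrt; last by rewrite mulr_ge0// ltW// gap_gt0.
      by rewrite ler_pM2l// Gk// v0.
    - by case/andP: uM => u0 _; rewrite /= u0 ltW.
    - by rewrite /= d0 lexx.
    - exact: ltW.
  have Cu : 0 <= C * Num.sqrt u by rewrite mulr_ge0// sqrtr_ge0.
  by move: Cu; lra.
(* Subtracting the infimum of [Y] makes the travel time tend to 0 with the pressure. *)
have infS : has_inf S by split; [exists (Y d), d|exists m].
apply: (@front_of_time (fun u => Y u - inf S)).
- move=> u uM; rewrite -[X in is_derive _ _ _ X]subr0.
  exact: is_deriveB (dY u uM) (is_derive_cst _ _ _).
- move=> u uM; have /andP[u0 upM] := uM; have u2M : 0 < u / 2 < pM.
    by rewrite divr_gt0//= (lt_trans _ upM)// ltr_pdivrMr// ltr_pMr// ltr1n.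
  rewrite subr_gt0 (le_lt_trans _ (_ : Y (u / 2) < _))//.
    by apply: ge_inf; [exact: infS.2|exists (u / 2)].
  by apply: Ylt => //; rewrite ltr_pdivrMr// ltr_pMr// ltr1n.
- move=> t t0; have [_ [u uM <-] ut] := inf_adherent t0 infS.
  by exists u => //; rewrite ltrBlDl.
- move=> t; pose s := Num.sqrt K; have s0 : 0 < s by rewrite sqrtr_gt0.
  pose u1 := pM / 2.
  have u1M : 0 < u1 < pM.
    by rewrite divr_gt0//= ltr_pdivrMr// ltr_pMr// ltr1n.
  (* Since s Y v + ln (pM - v) is nondecreasing in v, ln w <= - r gives s Y (pM - w) >= s (t + inf
     S) + 1. *)
  pose r := s * (t + inf S) - s * Y u1 - ln (pM - u1) + 1.
  pose w := Num.min u1 (expR (- r)).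
  have w0 : 0 < w by rewrite lt_min expR_gt0; case/andP: u1M => ->.
  have wu1 : w <= u1 by rewrite ge_min lexx.
  have lnw : ln w <= - r.
    by rewrite -[leRHS]expRK ler_ln ?posrE ?expR_gt0// ge_min lexx orbT.
  have u1w : u1 <= pM - w.
    by rewrite lerBrDr -lerBrDl (_ : pM - u1 = u1)// /u1; field.
  have uM : 0 < pM - w < pM.
    by rewrite (lt_le_trans _ u1w)//= ?ltrBlDr ?ltrDl//; case/andP: u1M.
  exists (pM - w) => //.
  have : s * Y u1 + ln (pM - u1) <= s * Y (pM - w) + ln (pM - (pM - w)).
    apply: (@derive_ge0_le_itv _ _ (fun v => s * Y v + ln (pM - v))
      (fun v => s * (Num.sqrt (2 * G v))^-1 + (pM - v)^-1 * (- 1)) _ _ itvM) => //.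
    - move=> v vM; have /andP[v0 vpM] := vM.
      have pv0 : 0 < pM - v by rewrite subr_gt0.
      have d1 := is_deriveZ s (dY v vM).
      have d2 : is_derive v 1 (fun v => pM - v) (- 1).
        by have := is_deriveB (is_derive_cst pM v 1) (is_derive_id v 1); rewrite sub0r.
      have d3 := @is_derive1_comp _ (@ln R) (fun v => pM - v) v _ _ (is_derive1_ln pv0) d2.
      exact: is_deriveD d1 d3.
    - move=> v vM; have /andP[v0 vpM] := vM.
      have pv0 : 0 < pM - v by rewrite subr_gt0.
      have Gv := gap_gt0 vM.
      have sG0 : 0 < Num.sqrt (2 * G v) by rewrite sqrtr_gt0 mulr_gt0.
      have GKv : Num.sqrt (2 * G v) <= s * (pM - v).
        have spv : 0 <= s * (pM - v) by apply: mulr_ge0; exact: ltW.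
        rewrite -[leRHS](ger0_norm spv) -sqrtr_sqr ler_sqrt; last exact: sqr_ge0.
        rewrite exprMn /s sqr_sqrtr; last exact: ltW.
        by apply: GK; rewrite !ltW.
      by rewrite mulrN1 subr_ge0 ler_pdivlMr// ler_pdivrMl// [_ * s]mulrC.
  rewrite subKr => H; rewrite ltrBrDr -(ltr_pM2l s0).
  by move: H lnw; rewrite /r; lra.
Qed.

End front_existence.

(** * From fronts to traveling waves *)

Section front_wave.
Context {R : realType}.
Local Notation mu := (@lebesgue_measure R).
Local Notation lbm := locally_bounded_measurable.
Implicit Types (a b u v x y z : R) (g h phi : R -> R).

Lemma test_function_support phi : test_function phi ->
  exists2 N : R, 0 < N & forall x, ~~ (- N <= x <= N) -> phi x = 0.
Proof.
move=> [_ /compact_bounded[M [_ HM]]].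
exists (`|M| + 1); first by rewrite ltr_wpDl.
move=> x; apply: contraNeq => phix; rewrite -ler_norml.
apply: HM; first by rewrite ltr_pwDr// ler_norm.
exact: subset_closure.
Qed.

Lemma test_function_derive phi n x : test_function phi ->
  is_derive x 1 (phi^`(n)) (phi^`(n.+1) x).
Proof.
move=> [dphi _]; apply: DeriveDef; first exact: dphi.
by rewrite derive1nS derive1E.
Qed.

Lemma test_function_continuous phi n : test_function phi -> continuous (phi^`(n)).
Proof. by move=> tphi x; exact: is_derive_continuous (test_function_derive n x tphi). Qed.

(** Splits at the jump of the density: [g] and [h] stand for regular extensions of the two pieces up
    to the closed endpoint [c]. *)
Lemma Rintegral_split a b (c : R) (u g h : R -> R) : a <= c -> c <= b ->
  lbm u -> lbm g -> lbm h ->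
  (forall x, x < c -> u x = g x) -> (forall x, c < x -> u x = h x) ->
  \int[mu]_(x in `[a, b]) u x = \int[mu]_(x in `[a, c]) g x + \int[mu]_(x in `[c, b]) h x.
Proof.
move=> ac cb lu lg lh ug uh.
have -> : \int[mu]_(x in `[a, b]) u x =
    \int[mu]_(x in `[a, c]) u x + \int[mu]_(x in `]c, b]) u x.
  by rewrite -(primB lu ac cb) /prim addrC subrK.
have io (v : R -> R) : lbm v -> mu.-integrable `[a, c[ (EFin \o v).
  move=> lv; apply: integrableS (lbm_integrable a c lv) => //.
  by apply: subset_itvl; rewrite bnd_simp.
have oi (v : R -> R) : lbm v -> mu.-integrable `]c, b] (EFin \o v).
  move=> lv; apply: integrableS (lbm_integrable c b lv) => //.
  by apply: subset_itvr; rewrite bnd_simp.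
congr (_ + _).
  rewrite -Rintegral_itv_bndo_bndc ?io// -[RHS]Rintegral_itv_bndo_bndc ?io//.
  by apply: eq_Rintegral => x; rewrite inE/= in_itv/= => /andP[_ /ug].
rewrite -[RHS]Rintegral_itv_obnd_cbnd ?oi//.
by apply: eq_Rintegral => x; rewrite inE/= in_itv/= => /andP[/uh].
Qed.

Variables (f F : R -> R) (pM l c : R) (p r r' : R -> R).
Local Notation G := (gap F pM).
Hypothesis pM_gt0 : 0 < pM.
Hypothesis f_cont : continuous (fun u : R => f (Num.max u 0)).
Hypothesis dF : forall u : R, is_derive u 1 F (f (Num.max u 0)).
Hypothesis gap_gt0 : forall u, 0 < u < pM -> 0 < G u.
Hypothesis fp : front F pM p 0.
Hypothesis p_nincr : nonincreasing_fun p.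
Hypothesis p_cvg : p x @[x --> -oo] --> pM.
Hypothesis dr : forall x, is_derive x 1 r (r' x).
Hypothesis r_ode : forall x, - c * r' x = r x * f 0.
Hypothesis r_jump : c * (r 0 - 1) = - Num.sqrt (2 * G 0).
Hypothesis r_nincr : nonincreasing_fun r.
Hypothesis r0_le1 : r 0 <= 1.
Hypothesis r_cvg : r x @[x --> +oo] --> l.

(** The tail [r] is given on the whole line to be differentiable at 0, and its negative half is
    discarded. It will be a constant or a decaying exponential. *)
Definition density x := if x < 0 then 1 else r x.

Let q x := - Num.sqrt (2 * G (p x)).

Let p_ge0 x : 0 <= p x.
Proof.
have [pb p0 _ _] := fp; have [x0|/p0->//] := ltP x 0.
by have /andP[/ltW] := pb x x0.
Qed.

Let p_continuous : continuous p. Proof. by case: fp. Qed.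

Let q_continuous : continuous q.
Proof.
move=> x; apply: cvgN; apply: continuous_comp; last exact: sqrt_continuous.
apply: cvgM; first exact: cvg_cst.
apply: continuous_comp; first exact: p_continuous.
exact: gap_continuous dF _ (p_ge0 x).
Qed.

Let dq x : x < 0 -> is_derive x 1 q (- f (p x)).
Proof.
move=> x0; have [pb _ _ dp] := fp; have G0 := gap_gt0 (pb x x0).
have G20 : 0 < 2 * G (p x) by rewrite mulr_gt0.
have d1 := is_derive1_comp (is_derive_gap pM dF (p_ge0 x)) (dp x x0).
have d2 := is_deriveN (@is_derive1_comp _ Num.sqrt (fun x => 2 * G (p x)) x _ _
  (is_derive1_sqrt G20) (is_deriveZ 2 d1)).
have s0 : Num.sqrt (2 * G (p x)) != 0 by rewrite gt_eqF// sqrtr_gt0.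
rewrite (_ : - f (p x) = - ((2 * Num.sqrt (2 * G (p x)))^-1 *
  (2 * (- f (p x) * - Num.sqrt (2 * G (p x)))))); last by field.
exact: d2.
Qed.

Lemma density_nincr : nonincreasing_fun density.
Proof.
move=> x y xy; rewrite /density; have [y0|y0] := ltP y 0.
  by rewrite (le_lt_trans xy y0).
have [x0|x0] := ltP x 0; last exact: r_nincr.
by rewrite (le_trans (r_nincr y0)).
Qed.

(** On each side of 0 the integrand is an exact derivative: of c phi - p phi' + p' phi on the left,
    of c r phi on the right. Since p 0 = 0, the boundary terms at 0 add up to phi 0 times c (1 - r
    0) - sqrt (2 gap 0), which is zero by [r_jump]. *)
Lemma front_weak_solution : weak_solution f c density p.
Proof.
move=> phi tphi; have [M M0 phiM] := test_function_support tphi.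
(* Strictly above [M], so that phi and phi' both vanish at -N and N, where the boundary terms are
   taken. *)
have [N MN] : exists N, M < N by exists (M + 1); rewrite ltrDl.
have N0 : 0 < N by exact: lt_trans MN.
have MNx x : ~~ (- N < x < N) -> ~~ (- M <= x <= M).
  by apply: contra => /andP[Mx xM]; rewrite (le_lt_trans xM MN) andbT (lt_le_trans _ Mx)// ltrN2.
have MNx' x : ~~ (- N <= x <= N) -> ~~ (- M <= x <= M).
  by move=> xN; apply: MNx; apply: contra xN => /andP[/ltW-> /ltW->].
have NMr : ~~ (- M <= N <= M) by apply: MNx; rewrite ltxx andbF.
have NMl : ~~ (- M <= - N <= M) by apply: MNx; rewrite ltxx.
have NN : - N <= N by rewrite (@le_trans _ _ 0)// ?oppr_le0 ltW.
have N00 : - N <= 0 by rewrite oppr_le0 ltW.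
have d0 := test_function_derive 0 _ tphi; have d1 := test_function_derive 1 _ tphi.
have c0 := @test_function_continuous phi 0 tphi; have c1 := @test_function_continuous phi 1 tphi.
have c2 := @test_function_continuous phi 2 tphi.
rewrite derive1n0 in d0 c0; rewrite derive1n1 in d0 d1 c1.
have phi1M := derive_out d0 phiM; have phi2M := derive_out d1 phi1M.
set phi1 := phi^`()%classic in d0 d1 c1 phi1M *.
set phi2 := phi^`(2)%classic in d1 c2 phi2M *.
rewrite (pairing_itv _ (fun x xN => phi1M x (MNx' x xN))).
rewrite (pairing_itv _ (fun x xN => phi2M x (MNx' x xN))).
rewrite (pairing_itv _ (fun x xN => phiM x (MNx' x xN))).
have lrho : lbm density by exact/nonincreasing_lbm/density_nincr.
have lp : lbm p by exact: continuous_lbm.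
have l0 : lbm phi by exact: continuous_lbm.
have l1 : lbm phi1 by exact: continuous_lbm.
have l2 : lbm phi2 by exact: continuous_lbm.
have cfp : continuous (fun x => f (p x)).
  rewrite (_ : (fun x => f (p x)) = (fun u => f (Num.max u 0)) \o p).
    by move=> x; apply: continuous_comp; [exact: p_continuous|exact: f_cont].
  by apply/funext => x /=; rewrite max_l.
have lfp : lbm (fun x => f (p x)) by exact: continuous_lbm.
have lw : lbm (fun x => density x * f (p x)) by exact: lbmM.
apply/eqP; rewrite -subr_eq0 opprD addrA -RintegralZl//; last exact/lbm_integrable/lbmM.
have lN g : lbm g -> lbm (fun x => - g x).
  move=> lg; rewrite (_ : (fun x => - g x) = fun x => -1 * g x); first exact: lbmZ.
  by apply/funext => x; rewrite mulN1r.
rewrite -RintegralB//; last 2 first.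
  exact/lbm_integrable/lbmZ/lbmM.
  exact/lbm_integrable/lbmM.
rewrite -RintegralB//; last 2 first.
  by apply/lbm_integrable/lbmD; [exact/lbmZ/lbmM|exact/lN/lbmM].
  exact/lbm_integrable/lbmM.
pose h1 x := c * phi1 x - p x * phi2 x - f (p x) * phi x.
pose h2 x := c * (r x * phi1 x) - r x * f 0 * phi x.
have cr : continuous r by move=> x; exact: is_derive_continuous (dr x).
have ch1 : continuous h1.
  move=> x; apply: cvgB; last by apply: cvgM; [exact: cfp|exact: c0].
  apply: cvgB; last by apply: cvgM; [exact: p_continuous|exact: c2].
  by apply: cvgM; [exact: cvg_cst|exact: c1].
have ch2 : continuous h2.
  move=> x; apply: cvgB.
    by apply: cvgM; [exact: cvg_cst|apply: cvgM; [exact: cr|exact: c1]].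
  apply: cvgM; last exact: c0.
  by apply: cvgM; [exact: cr|exact: cvg_cst].
have [pb p0 _ dp] := fp.
rewrite (@Rintegral_split (- N) N 0 _ h1 h2)//; last 6 first.
- exact: ltW.
- apply: lbmD; last exact/lN/lbmM.
  by apply: lbmD; [exact/lbmZ/lbmM|exact/lN/lbmM].
- exact: continuous_lbm.
- exact: continuous_lbm.
- by move=> x x0; rewrite /density x0 /h1; ring.
- move=> x x0; rewrite /density ltNge (ltW x0)/= /h2 (p0 _ (ltW x0)); ring.
pose H x := c * phi x - p x * phi1 x + q x * phi x.
have cH : continuous H.
  move=> x; apply: cvgD; last by apply: cvgM; [exact: q_continuous|exact: c0].
  apply: cvgB; last by apply: cvgM; [exact: p_continuous|exact: c1].
  by apply: cvgM; [exact: cvg_cst|exact: c0].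
have dH x : x < 0 -> is_derive x 1 H (h1 x).
  move=> x0; have e1 := is_deriveZ c (d0 x).
  have e2 := is_deriveM (dp x x0) (d1 x).
  have e3 := is_deriveM (dq x0) (d0 x).
  have e4 := is_deriveD (is_deriveB e1 e2) e3.
  rewrite (_ : h1 x = c *: phi1 x -
    (p x *: phi2 x + phi1 x *: - Num.sqrt (2 * G (p x))) +
    (q x *: phi1 x + phi x *: - f (p x))); first exact: e4.
  by rewrite /h1 /q /GRing.scale/=; ring.
have -> : \int[mu]_(x in `[- N, 0]) h1 x = H 0 - H (- N).
  rewrite /Rintegral (@continuous_FTC2 _ h1 H)//; first by rewrite oppr_lt0.
  - exact: continuous_subspaceT.
  - split=> [x|//|//].
    + by rewrite in_itv/= => /andP[_ /dH[]].
    + exact/cvg_at_right_filter/cH.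
    + exact/cvg_at_left_filter/cH.
  - by move=> x; rewrite in_itv/= => /andP[_ /dH/is_derive1E].
have -> : \int[mu]_(x in `[0, N]) h2 x = c * (r N * phi N) - c * (r 0 * phi 0).
  apply: (@Rintegral_FTC2 _ (fun x => c * (r x * phi x))) => //; first exact: ltW.
  move=> x; have e1 := is_deriveZ c (is_deriveM (dr x) (d0 x)).
  rewrite (_ : h2 x = c *: (r x *: phi1 x + phi x *: r' x)); first exact: e1.
  by rewrite /h2 -r_ode /GRing.scale/=; ring.
rewrite /H (p0 0)// (phiM _ NMr) (phiM _ NMl) (phi1M _ NMl) /q (p0 0)// -r_jump.
by apply/eqP; ring.
Qed.

Lemma front_traveling_wave : traveling_wave f pM l c density p.
Proof.
have [pb p0 _ _] := fp.
split => //; [exact: density_nincr|exact: front_weak_solution| |split => //].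
- apply: aeW => x; rewrite /hele_shaw_graph /density.
  have [x0|x0] := ltP x 0; first by rewrite ltxx eqxx/= lee_fin ltry p_ge0.
  rewrite (p0 x x0); have : r x <= 1 by rewrite (le_trans (r_nincr x0)).
  rewrite le_eqVlt => /predU1P[->|->//]; first by rewrite ltxx eqxx/= lexx ltry.
- apply: cvg_near_cst; near=> x.
  by rewrite /density ifT//; near: x; apply: nbhs_ninfty_lt; rewrite num_real.
- apply: cvg_trans r_cvg; apply: near_eq_cvg; near=> x.
  rewrite /density ifF//; apply/negbTE; rewrite -leNgt.
  by near: x; apply: nbhs_pinfty_ge; rewrite num_real.
- apply: cvg_near_cst; near=> x.
  by rewrite p0//; near: x; apply: nbhs_pinfty_ge; rewrite num_real.
Unshelve. all: by end_near. Qed.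

End front_wave.

(** * Classification *)

Section classification.
Context {R : realType}.
Local Notation mu := (@lebesgue_measure R).
Implicit Types (u v x y l c K k d : R) (rho p : R -> R).

Lemma lipschitz_nonneg (f : R -> R) : [lipschitz f u | u in [set u : R | 0 <= u]] ->
  exists2 K, 0 < K &
    forall u v, 0 <= u -> 0 <= v -> `|f u - f v| <= K * `|u - v|.
Proof.
move=> lf; near (pinfty_nbhs R) => K; exists K.
  by near: K; apply: nbhs_pinfty_gt; rewrite num_real.
have lK : K.-lipschitz_[set u : R | 0 <= u] f by near: K; exact: lf.
by move=> u v u0 v0; exact: (lK (u, v)).
Unshelve. all: by end_near. Qed.

Lemma ae_neq a : \forall x \ae mu, x != a :> R.
Proof.
have na : mu.-negligible [set a].
  by exists [set a]; split => //; exact: lebesgue_measure_set1.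
by apply: negligibleS na => x /= /negP; rewrite negbK => /eqP.
Qed.

Variables (f F : R -> R) (pM K : R).
Local Notation G := (gap F pM).
Hypothesis pM_gt0 : 0 < pM.
Hypothesis K_gt0 : 0 < K.
Hypothesis f_lip : forall u v, 0 <= u -> 0 <= v -> `|f u - f v| <= K * `|u - v|.
Hypothesis dF : forall u, is_derive u 1 F (f (Num.max u 0)).
Hypothesis f_cont : continuous (fun u : R => f (Num.max u 0)).
Hypothesis fpM : f pM = 0.

Lemma reaction_integralE : reaction_integral f pM = G 0.
Proof.
rewrite /gap -(Rintegral_FTC2 (ltW pM_gt0) dF f_cont).
apply: eq_Rintegral => u; rewrite inE/= in_itv/= => /andP[u0 _].
by rewrite max_l.
Qed.

(** The necessary conditions common to all cases. [0 <= G 0] is the limit at the interface of 2 gap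
    p = p'^2, and the speed relation equates the two expressions of p'(x0-), from the jump and from
    the energy. *)
Lemma wave_front l c rho p : 0 <= l < 1 -> traveling_wave f pM l c rho p ->
  exists x0 r : R,
  [/\ front F pM p x0, forall x, x < x0 -> rho x = 1,
      rho y @[y --> x0^'+] --> r, l <= r <= 1 &
      [/\ 0 <= G 0, c * (r - 1) = - Num.sqrt (2 * G 0),
          c != 0 -> forall x, x0 < x -> is_derive x 1 rho (- (f 0 / c) * rho x) &
          c = 0 -> f 0 != 0 -> forall x, x0 < x -> rho x = 0]].
Proof.
move=> l01 tw; have [drho dp _ _ [_ rhol pcvg _]] := tw.
have [x0 [left right]] := interface_exists pM_gt0 l01 tw.
have [r rr] := nonincreasing_right_cvg x0 drho.
have ode x := @wave_ode _ _ _ _ _ _ _ f_cont tw x0 left right x.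
have pb := p_bounds tw; have cp := p_continuous f_cont tw.
have pr x := @p_right _ _ _ _ _ _ _ f_cont tw x0 right x.
have energy := orbit_energy pM_gt0 dF ode dp pb pcvg.
have qE x : x < x0 -> p^`()%classic x = - Num.sqrt (2 * G (p x)).
  move=> /energy[q0 qq]; rewrite -qq sqrtr_sqr ler0_norm ?opprK//.
have dpx x : x < x0 -> is_derive x 1 p (- Num.sqrt (2 * G (p x))).
  by move=> xx0; rewrite -qE//; exact: (ode x xx0).1.
have px0 : p x0 = 0 by apply: pr.
have plt := orbit_lt pM_gt0 dF f_lip fpM cp pb px0 dpx.
have jump := wave_jump f_cont tw left right rr.
have G0cvg : G (p x) @[x --> x0^'-] --> G 0.
  rewrite -px0; apply: cvg_at_left_filter.
  apply: continuous_comp; first exact: cp.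
  by apply: gap_continuous dF _ _; case/andP: (pb x0).
have qcvg : p^`()%classic x @[x --> x0^'-] --> - Num.sqrt (2 * G 0).
  apply: (@cvg_trans _ ((- Num.sqrt (2 * G (p x))) @[x --> x0^'-])).
    by apply: near_eq_cvg; near=> x; rewrite qE.
  have G2cvg : 2 * G (p x) @[x --> x0^'-] --> 2 * G 0.
    by apply: cvgM => //; exact: cvg_cst.
  apply: cvgN; exact: cvg_comp G2cvg (@sqrt_continuous _ _).
exists x0, r; split => //.
- split => //.
  by move=> x xx0; rewrite (left x xx0).1 plt.
- by move=> x /left[].
- apply/andP; split.
    by apply: (cvgr_to_ge rr); near=> y; case/andP: (rho_bounds tw y).
  by apply: (cvgr_to_le rr); near=> y; case/andP: (rho_bounds tw y).
- split.
  + apply: (cvgr_to_ge G0cvg); near=> y.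
    have [_ qq] : p^`()%classic y <= 0 /\ p^`()%classic y ^+ 2 = 2 * G (p y).
      exact: energy.
    by have := sqr_ge0 (p^`()%classic y); rewrite qq pmulr_rge0.
  + exact: (cvg_unique _ jump qcvg).
  + by move=> c0 x; exact: (wave_tail f_cont tw left right c0).
  + by move=> c0 f0 x; exact: (wave_tail0 l01 f_cont tw left right c0 f0).
Unshelve. all: by end_near. Qed.

(** The shift that matches the pressures matches the interfaces, hence the densities away from the
    interface itself. *)
Lemma constant_tail_translates l rho1 p1 rho2 p2 x1 x2 :
  (forall u, 0 < u < pM -> 0 < G u) ->
  front F pM p1 x1 -> front F pM p2 x2 ->
  (forall x, x < x1 -> rho1 x = 1) -> (forall x, x < x2 -> rho2 x = 1) ->
  (forall x, x1 < x -> rho1 x = l) -> (forall x, x2 < x -> rho2 x = l) ->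
  translates rho1 p1 rho2 p2.
Proof.
move=> Gpos fp1 fp2 l1 l2 r1 r2; exists (x1 - x2); split; last first.
  by apply: aeW => x; exact: (front_unique dF Gpos fp1 fp2).
apply: negligibleS (ae_neq x2) => x /=; apply: contra_not => xx2.
move: xx2; rewrite neq_lt => /orP[xx2|x2x].
  by rewrite l2// l1//; move: xx2; lra.
by rewrite r2// r1//; move: x2x; lra.
Qed.

(** A constant lower bound G 0 / 2 near 0, weakened to a linear one so that [front_exists] covers
    this case and the case of zero integral alike. *)
Lemma gap_linear_of_pos : 0 < G 0 -> exists k d : R,
  [/\ 0 < k, 0 < d < pM & forall u, 0 < u <= d -> k * u <= G u].
Proof.
move=> G0; have cG : {for 0, continuous G} by exact: gap_continuous dF _ (lexx _).
have G20 : G 0 / 2 < G 0 by rewrite ltr_pdivrMr// ltr_pMr// ltr1n.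
have [d [d0 dM Gd]] : exists d : R, [/\ 0 < d, d < pM & forall u, 0 < u <= d -> G 0 / 2 <= G u].
  have /nbhs_ballP[e/= e0 eG] : \forall u \near (0 : R), G 0 / 2 <= G u.
    exact: cvgr_ge cG _ G20.
  pose d := Num.min (e / 2) (pM / 2).
  exists d; split.
  - by rewrite lt_min !divr_gt0.
  - apply: (@le_lt_trans _ _ (pM / 2)); first by rewrite ge_min lexx orbT.
    by rewrite ltr_pdivrMr// ltr_pMr// ltr1n.
  - move=> u /andP[u0 ud]; apply: eG; rewrite /ball/= sub0r normrN gtr0_norm//.
    rewrite (le_lt_trans ud)//; apply: (@le_lt_trans _ _ (e / 2)).
      by rewrite ge_min lexx.
    by rewrite ltr_pdivrMr// ltr_pMr// ltr1n.
exists (G 0 / 2 / d), d; split; [by rewrite !divr_gt0|by rewrite d0|].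
move=> u ud; rewrite (le_trans _ (Gd _ ud))//; move/andP: ud => [u0 ud].
by rewrite -[leRHS](divfK (lt0r_neq0 d0)) ler_pM2l// !divr_gt0.
Qed.

(** The derivative of the gap at 0 is - f 0 > 0; [k] is half of it, a margin that continuity
    preserves near 0. *)
Lemma gap_linear_of_neg : G 0 = 0 -> f 0 < 0 -> exists k d : R,
  [/\ 0 < k, 0 < d < pM & forall u, 0 < u <= d -> k * u <= G u].
Proof.
move=> G0 f0; pose k := - f 0 / 2.
have k0 : 0 < k by rewrite divr_gt0// oppr_gt0.
have fk : f (Num.max 0 0) < - k by rewrite maxxx /k; lra.
have [d [d0 dM fd]] : exists d : R, [/\ 0 < d, d < pM & forall u, 0 <= u <= d -> f u <= - k].
  have /nbhs_ballP[e/= e0 eG] : \forall u \near (0 : R), f (Num.max u 0) <= - k.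
    have fc0 : f (Num.max u 0) @[u --> (0 : R)] --> f (Num.max 0 0) by exact: f_cont.
    exact: cvgr_le fc0 _ fk.
  pose d := Num.min (e / 2) (pM / 2).
  exists d; split.
  - by rewrite lt_min !divr_gt0.
  - apply: (@le_lt_trans _ _ (pM / 2)); first by rewrite ge_min lexx orbT.
    by rewrite ltr_pdivrMr// ltr_pMr// ltr1n.
  - move=> u /andP[u0 ud]; rewrite -(max_l u0); apply: eG.
    rewrite /ball/= sub0r normrN ger0_norm//.
    rewrite (le_lt_trans ud)//; apply: (@le_lt_trans _ _ (e / 2)).
      by rewrite ge_min lexx.
    by rewrite ltr_pdivrMr// ltr_pMr// ltr1n.
exists k, d; split; [by []|by rewrite d0|].
move=> u /andP[u0 ud]; rewrite -subr_ge0.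
have -> : 0 = G 0 - k * 0 by rewrite G0 mulr0 subr0.
have itvI : is_interval [set u | 0 <= u <= d].
  move=> a b /andP[a0 _] /andP[_ bd] z /andP[az zb] /=.
  by rewrite (le_trans a0)// (le_trans zb).
apply: (@derive_ge0_le_itv _ _ (fun u => G u - k * u) (fun u => - f u - k * 1) _ _ itvI).
- move=> v /andP[v0 vd].
  exact: is_deriveB (is_derive_gap pM dF v0) (is_deriveZ k (is_derive_id v 1)).
- by move=> v /fd; lra.
- by rewrite /= lexx ltW.
- by rewrite /= (ltW u0).
- exact: ltW.
Qed.

Lemma front_exists_of_linear : (forall u, 0 < u < pM -> 0 < G u) ->
  (exists k d : R, [/\ 0 < k, 0 < d < pM & forall u, 0 < u <= d -> k * u <= G u]) ->
  exists p, [/\ front F pM p 0, nonincreasing_fun p & p x @[x --> -oo] --> pM].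
Proof.
move=> Gpos [k [d [k0 dM Gk]]].
apply: (front_exists pM_gt0 dF Gpos K_gt0 k0 dM _ Gk) => u.
exact: gap_le_quadratic.
Qed.

(** [l * f 0 = 0] is the tail equation of a constant density: it holds with l = 0 in the bistable
    case and by f 0 = 0 in the monostable one. The speed is then read off the jump relation. *)
Lemma constant_wave_exists l : (forall u, 0 < u < pM -> 0 < G u) -> 0 < G 0 ->
  0 <= l < 1 -> l * f 0 = 0 ->
  exists rho p, traveling_wave f pM l ((1 - l)^-1 * Num.sqrt (2 * G 0)) rho p.
Proof.
move=> Gpos G0 /andP[l0 l1] lf0.
have [p [fp dp pcvg]] := front_exists_of_linear Gpos (gap_linear_of_pos G0).
exists (density (cst l)), p.
apply: (@front_traveling_wave _ f F pM l _ p (cst l) (cst 0)) => //.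
- by move=> x /=; rewrite mulr0 lf0.
- have : 1 - l != 0 by rewrite gt_eqF// subr_gt0.
  by move=> l1' /=; field.
- exact: ltW.
- exact: cvg_cst.
Qed.

(** With G 0 = 0 the density cannot jump, so the tail starts from 1 and is exp(- (f 0 / c) x),
    decaying because f 0 and c are both negative. *)
Lemma exponential_wave_exists c : (forall u, 0 < u < pM -> 0 < G u) -> G 0 = 0 ->
  f 0 < 0 -> c < 0 -> exists rho p, traveling_wave f pM 0 c rho p.
Proof.
move=> Gpos G0 f0 c0.
have [p [fp dp pcvg]] := front_exists_of_linear Gpos (gap_linear_of_neg G0 f0).
pose k := f 0 / c; have k0 : 0 < k by rewrite nmulr_lgt0// invr_lt0.
exists (density (fun x => expR (- (k * x)))), p.
have dr x : is_derive x 1 (fun x => expR (- (k * x))) (expR (- (k * x)) * - k).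
  have d2 : is_derive x 1 (fun y => - (k * y)) (- k).
    by have := is_deriveN (is_deriveZ k (is_derive_id x 1)); rewrite /GRing.scale/= mulr1.
  exact: (@is_derive1_comp _ expR (fun y => - (k * y)) x _ _ (is_derive_expR _) d2).
apply: (@front_traveling_wave _ f F pM 0 c p _ (fun x => expR (- (k * x)) * - k)) => //.
- by move=> x /=; rewrite /k; field; rewrite lt_eqF.
- by rewrite /= G0 !mulr0 oppr0 expR0 subrr sqrtr0 mulr0 oppr0.
- by move=> x y xy /=; rewrite ler_expR lerN2 ler_pM2l.
- by rewrite /= mulr0 oppr0 expR0.
- have kcvg : k * x @[x --> +oo] --> +oo.
    by apply: gt0_cvgMry => //; exact: cvg_id.
  exact: cvg_comp kcvg (@cvgr_expR _).
Qed.

(** At zero speed the tail equation reads 0 = r f 0, and f 0 < 0 leaves only the vacuum. *)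
Lemma rest_wave_exists : (forall u, 0 < u < pM -> 0 < G u) -> G 0 = 0 ->
  f 0 < 0 -> exists rho p, traveling_wave f pM 0 0 rho p.
Proof.
move=> Gpos G0 f0.
have [p [fp dp pcvg]] := front_exists_of_linear Gpos (gap_linear_of_neg G0 f0).
exists (density (cst 0)), p.
apply: (@front_traveling_wave _ f F pM 0 0 p (cst 0) (cst 0)) => //.
- by move=> x /=; rewrite mulr0 mul0r.
- by rewrite mul0r G0 mulr0 sqrtr0 oppr0.
- exact: cvg_cst.
Qed.

End classification.

(** * Tails of the density and sign of the gap *)

Section tails.
Context {R : realType}.
Implicit Types (a c l k r u v x y : R) (f g rho p : R -> R).

Lemma lipschitz_clip_continuous f k :
  (forall u v, 0 <= u -> 0 <= v -> `|f u - f v| <= k * `|u - v|) ->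
  continuous (fun u => f (Num.max u 0)).
Proof.
move=> flip x; apply/cvgrPdist_le => e e0.
have k0 : 0 <= k.
  have := flip 1 0 ler01 (lexx 0); rewrite subr0 normr1 mulr1.
  by apply: le_trans.
near=> y; rewrite (le_trans (flip _ _ _ _)) ?le_max ?lexx ?orbT//.
have clip : `|Num.max x 0 - Num.max y 0| <= `|x - y|.
  rewrite !maxr_absE !subr0 !addr0 -mulrBl normrM (ger0_norm (_ : 0 <= 2^-1))//.
  rewrite ler_pdivrMr// opprD addrACA (le_trans (ler_normD _ _))//.
  by rewrite mulr_natr mulr2n lerD2l ler_dist_dist.
have xy : `|x - y| <= e / (k + 1).
  near: y; apply: (@cvgr_dist_le _ _ _ (nbhs x) _ id x) => //.
  by rewrite divr_gt0// ltr_wpDl.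
rewrite (@le_trans _ _ ((k + 1) * `|x - y|))//.
  by rewrite ler_pM// lerDl.
by rewrite mulrC -ler_pdivlMr// ltr_wpDl.
Unshelve. all: by end_near. Qed.

(** Provides f pM = 0, which the bistable and monostable hypotheses leave implicit. *)
Lemma sign_change_zero g a x : continuous g -> a < x ->
  (forall u, a < u < x -> 0 < g u) -> (forall u, x < u -> g u < 0) -> g x = 0.
Proof.
move=> cg ax gpos gneg; apply/eqP; rewrite eq_le; apply/andP; split.
  have gr : g y @[y --> x^'+] --> g x by exact/cvg_at_right_filter/cg.
  by apply: (cvgr_to_le gr); near=> y; apply/ltW/gneg.
have gl : g y @[y --> x^'-] --> g x by exact/cvg_at_left_filter/cg.
apply: (cvgr_to_ge gl); near=> y; apply/ltW/gpos; apply/andP; split.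
  by near: y; exact: nbhs_left_gt.
by near: y; exact: nbhs_left_lt.
Unshelve. all: by end_near. Qed.

Lemma right_limit_eq rho x l r : rho y @[y --> x^'+] --> r ->
  (forall y, x < y -> rho y = l) -> r = l.
Proof.
move=> rr rl; apply/eqP; rewrite eq_le; apply/andP; split.
  by apply: (cvgr_to_le rr); near=> y; rewrite rl.
by apply: (cvgr_to_ge rr); near=> y; rewrite rl.
Unshelve. all: by end_near. Qed.

Lemma constant_tail rho x0 l : rho x @[x --> +oo] --> l ->
  (forall x, x0 < x -> is_derive x 1 rho 0) -> forall x, x0 < x -> rho x = l.
Proof.
move=> rhol drho x x0x.
have itvI : is_interval [set x | x0 < x].
  by move=> a b ax _ z /andP[az _]; exact: lt_le_trans az.
have cst_rho y : x <= y -> rho y = rho x.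
  by move=> xy; apply: (derive0_cst_itv itvI drho) => //; exact: lt_le_trans xy.
have near_cst : \forall y \near +oo, rho y = rho x.
  by apply: filterS (nbhs_pinfty_ge (num_real x)) => y /cst_rho.
apply/eqP; rewrite eq_le; apply/andP; split.
  by apply: (cvgr_to_ge rhol); apply: filterS near_cst => y ->.
by apply: (cvgr_to_le rhol); apply: filterS near_cst => y ->.
Qed.

(* rho expR (k x) is constant on the tail, so a zero would force r = 0. *)
Lemma exponential_tail_gt0 rho x0 k r : (forall x, 0 <= rho x) ->
  rho y @[y --> x0^'+] --> r -> 0 < r ->
  (forall x, x0 < x -> is_derive x 1 rho (- k * rho x)) ->
  forall x, x0 < x -> 0 < rho x.
Proof.
move=> rho0 rr r0 drho x x0x; rewrite lt0r rho0 andbT; apply/eqP => rx0.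
have itvI : is_interval [set x | x0 < x].
  by move=> a b ax _ z /andP[az _]; exact: lt_le_trans az.
have dm y : x0 < y -> is_derive y 1 (fun y => rho y * expR (k * y)) 0.
  move=> x0y; have d2 : is_derive y 1 (fun y => k * y) k.
    by have := is_deriveZ k (is_derive_id y 1); rewrite /GRing.scale/= mulr1.
  have d3 := @is_derive1_comp _ expR (fun y => k * y) y _ _ (is_derive_expR _) d2.
  rewrite (_ : 0 = rho y * (expR (k * y) * k) + expR (k * y) * (- k * rho y)); last ring.
  exact: is_deriveM (drho y x0y) d3.
have rho_zero y : x0 < y -> rho y = 0.
  move=> x0y; have := derive0_cst_itv itvI dm x0y x0x.
  by rewrite rx0 mul0r => /eqP; rewrite mulf_eq0 expR_eq0 orbF => /eqP.
by move: r0; rewrite (right_limit_eq rr rho_zero) ltxx.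
Qed.

Variables (f F : R -> R) (pM : R).
Local Notation G := (gap F pM).
Hypothesis dF : forall u : R, is_derive u 1 F (f (Num.max u 0)).

Lemma gap_mvt u v : 0 <= u -> u < v ->
  exists2 z, u < z < v & G v - G u = - f z * (v - u).
Proof.
move=> u0 uv.
have itvI : is_interval [set z : R | 0 <= z].
  by move=> a b a0 _ z /andP[az _]; exact: le_trans az.
apply: (mvt_itv itvI _ u0 (ltW (le_lt_trans u0 uv)) uv) => z z0.
exact: is_derive_gap.
Qed.

Lemma gap_gt0_of_pos a u : (forall z : R, a < z < pM -> 0 < f z) ->
  a <= u -> 0 <= u -> u < pM -> 0 < G u.
Proof.
move=> fpos au u0 upM; have [z /andP[uz zpM]] := gap_mvt u0 upM.
have -> : G pM = 0 by rewrite /gap subrr.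
rewrite sub0r mulNr => /oppr_inj ->.
by rewrite mulr_gt0 ?subr_gt0// fpos// zpM (le_lt_trans au).
Qed.

(** In the bistable case the gap increases on [0, alpha] from [G 0 >= 0] and then decreases to 0 at
    pM; this is the first half. *)
Lemma gap_gt0_of_neg a u : (forall z : R, 0 <= z < a -> f z < 0) ->
  0 < u -> u <= a -> 0 <= G 0 -> 0 < G u.
Proof.
move=> fneg u0 ua G0; have [z /andP[z0 zu]] := gap_mvt (lexx 0) u0.
rewrite subr0 => e; apply: (le_lt_trans G0); rewrite -subr_gt0 e.
by rewrite mulr_gt0// oppr_gt0 fneg// (ltW z0)/= (lt_le_trans zu).
Qed.

End tails.

Theorem proposition1p11 (R : realType) (f : R -> R) (pM : R)
    (f_lip : [lipschitz f u | u in [set u : R | 0 <= u]]) (pM_gt0 : 0 < pM) :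
  (bistable f pM ->
    [/\ (reaction_integral f pM < 0 ->
          forall (c : R) (rho p : R -> R), ~ traveling_wave f pM 0 c rho p),
        (reaction_integral f pM = 0 ->
          [/\ (forall c : R, c <= 0 ->
                exists rho p : R -> R, traveling_wave f pM 0 c rho p),
              (forall (c : R) (rho p : R -> R), c < 0 ->
                traveling_wave f pM 0 c rho p -> supp_ae rho [set: R]) &
              (forall rho p : R -> R, traveling_wave f pM 0 0 rho p ->
                exists h : R,
                  supp_ae (fun x => rho (x + h)) [set x : R | x < 0])]) &
        (0 < reaction_integral f pM ->
          unique_up_to_translation
            (fun rho p => exists c : R, traveling_wave f pM 0 c rho p) /\
          (forall (c : R) (rho p : R -> R),
            traveling_wave f pM 0 c rho p -> c = cstar f pM))]) /\
  (monostable f pM ->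
    forall l : R, 0 <= l < 1 ->
      [/\ unique_up_to_translation
            (fun rho p =>
              exists2 c : R, c != 0 & traveling_wave f pM l c rho p),
          (forall (c : R) (rho p : R -> R), c != 0 ->
            traveling_wave f pM l c rho p ->
            c = (1 - l)^-1 * cstar f pM) &
          cstar f pM <= (1 - l)^-1 * cstar f pM]).
Proof.
have [K K0 flip] := lipschitz_nonneg f_lip.
have fcont := lipschitz_clip_continuous flip.
have [F dF] := antiderivative fcont.
have intE := reaction_integralE pM_gt0 dF fcont.
have csE : cstar f pM = Num.sqrt (2 * gap F pM 0) by rewrite /cstar intE.
have fpM0 a : 0 <= a -> a < pM -> (forall u, a < u < pM -> 0 < f u) ->
    (forall u, pM < u -> f u < 0) -> f pM = 0.
  move=> a0 apM fpos fneg.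
  have := @sign_change_zero _ (fun u => f (Num.max u 0)) a pM fcont apM.
  rewrite (max_l (ltW pM_gt0)); apply.
    by move=> u /andP[au uM]; rewrite max_l ?fpos ?au// ltW// (le_lt_trans a0).
  by move=> u pMu; rewrite max_l ?fneg// ltW// (lt_trans pM_gt0).
have speed l c : l < 1 -> c * (l - 1) = - Num.sqrt (2 * gap F pM 0) ->
    c = (1 - l)^-1 * cstar f pM.
  move=> l1 cl; rewrite csE -[Num.sqrt _]opprK -cl.
  by field; rewrite gt_eqF// subr_gt0.
split.
- move=> [a [/andP[a0 apM] fpos fneg fneg']].
  have fpM := fpM0 a (ltW a0) apM fpos fneg'.
  have f0 : f 0 < 0 by rewrite fneg// lexx.
  have l01 : 0 <= (0 : R) < 1 by rewrite lexx ltr01.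
  have gpos : 0 <= gap F pM 0 -> forall u, 0 < u < pM -> 0 < gap F pM u.
    move=> G0 u /andP[u0 upM]; have [ua|au] := leP u a.
      exact: (gap_gt0_of_neg dF fneg u0 ua G0).
    exact: (gap_gt0_of_pos dF fpos (ltW au) (ltW u0) upM).
  have wf c rho p := @wave_front _ f F pM K pM_gt0 flip dF fcont fpM 0 c rho p l01.
  have rho_ge0 c rho p : traveling_wave f pM 0 c rho p -> forall x, 0 <= rho x.
    by move=> tw x; case/andP: (rho_bounds tw x).
  rewrite intE; split.
  + move=> I0 c rho p tw; have [_ [_ [_ _ _ _ [+ _ _ _]]]] := wf _ _ _ tw.
    by rewrite leNgt I0.
  + move=> I0; have Gp := gpos (eq_ind_r (fun z => 0 <= z) (lexx 0) I0).
    split.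
    * move=> c; rewrite le_eqVlt => /predU1P[->|c0].
        exact: (rest_wave_exists pM_gt0 K0 flip dF fcont fpM Gp I0 f0).
      exact: (exponential_wave_exists pM_gt0 K0 flip dF fcont fpM Gp I0 f0 c0).
    * move=> c rho p c0 tw; have [x0 [r [_ left rr _ [_ + dr _]]]] := wf _ _ _ tw.
      (* With zero gap the jump relation reads c (r - 1) = 0, so r = 1 and the tail starts from a
         positive value. *)
      rewrite I0 mulr0 sqrtr0 oppr0 => /eqP; rewrite mulf_eq0 (lt_eqF c0)/=.
      rewrite subr_eq0 => /eqP r1.
      have pos := exponential_tail_gt0 (rho_ge0 _ _ _ tw) rr _ (dr (negbT (lt_eqF c0))).
      apply: aeW => x; split => // _; have [xx0|x0x] := ltP x x0.
        by rewrite left.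
      have [drho _ _ _ _] := tw.
      (* Positivity of the tail is known only strictly beyond x0; comparing with x + 1 includes x =
         x0. *)
      have xx1 : x < x + 1 by rewrite ltrDl.
      apply: lt_le_trans (drho _ _ (ltW xx1)); apply: pos.
        by rewrite r1.
      exact: le_lt_trans xx1.
    * move=> rho p tw; have [x0 [r [_ left _ _ [_ _ _ right]]]] := wf _ _ _ tw.
      exists x0; apply: negligibleS (ae_neq 0) => x /=; apply: contra_not => x0'.
      move: x0'; rewrite neq_lt => /orP[xneg|xpos].
        by rewrite left ?xneg ?ltr01//; move: xneg; lra.
      rewrite (right erefl) ?ltxx; [|by rewrite lt_eqF|by move: xpos; lra].
      by split=> //; rewrite ltNge (ltW xpos).
  + move=> I0; have Gp := gpos (ltW I0).
    have analysis c rho p : traveling_wave f pM 0 c rho p ->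
        exists x0, [/\ front F pM p x0, forall x, x < x0 -> rho x = 1,
          forall x, x0 < x -> rho x = 0 & c = cstar f pM].
      move=> tw; have [x0 [r [fp left rr /andP[_ r1] [_ jump dr _]]]] := wf _ _ _ tw.
      have [drho _ _ _ _] := tw.
      have sq0 : 0 < Num.sqrt (2 * gap F pM 0) by rewrite sqrtr_gt0 mulr_gt0.
      (* As r <= 1, a speed c <= 0 would make c (r - 1) nonnegative, whereas it equals - sqrt (2 gap
         0) < 0. *)
      have c0 : 0 < c.
        rewrite ltNge; apply/negP => c0; have : 0 <= c * (r - 1).
          by rewrite mulr_le0// subr_le0.
        by rewrite jump oppr_ge0 leNgt sq0.
      (* The tail equation gives rho' = - (f 0 / c) rho with a positive coefficient, while
         monotonicity gives rho' <= 0; hence rho <= 0. *)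
      have right x : x0 < x -> rho x = 0.
        move=> x0x; apply/eqP; rewrite eq_le (rho_ge0 _ _ _ tw) andbT.
        have := nonincreasing_derive_le0 drho (dr (lt0r_neq0 c0) x x0x).
        by rewrite pmulr_rle0// oppr_gt0 pmulr_llt0// invr_gt0.
      exists x0; split => //.
      rewrite (speed 0 c ltr01) ?subr0 ?invr1 ?mul1r//.
      by rewrite -jump (right_limit_eq rr right).
    split; last by move=> c rho p /analysis[x0 []].
    split.
      have [rho [p tw]] := constant_wave_exists pM_gt0 K0 flip dF fcont fpM Gp I0 l01 (mul0r _).
      by exists rho, p; eexists; exact: tw.
    move=> rho1 p1 rho2 p2 [c1 /analysis[x1 [fp1 l1 r1 _]]] [c2 /analysis[x2 [fp2 l2 r2 _]]].
    exact: (constant_tail_translates dF Gp fp1 fp2 l1 l2 r1 r2).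
- move=> [f0 fpos fneg'] l /[dup] l01 /andP[l0 l1].
  have fpM := fpM0 0 (lexx 0) pM_gt0 fpos fneg'.
  have Gp u : 0 < u < pM -> 0 < gap F pM u.
    by move=> /andP[u0 upM]; exact: (gap_gt0_of_pos dF fpos (ltW u0) (ltW u0) upM).
  have I0 : 0 < gap F pM 0 by exact: (gap_gt0_of_pos dF fpos (lexx 0) (lexx 0) pM_gt0).
  have cs0 : 0 < cstar f pM by rewrite csE sqrtr_gt0 mulr_gt0.
  have l10 : 0 < 1 - l by rewrite subr_gt0.
  have analysis c rho p : c != 0 -> traveling_wave f pM l c rho p ->
      exists x0, [/\ front F pM p x0, forall x, x < x0 -> rho x = 1,
        forall x, x0 < x -> rho x = l & c = (1 - l)^-1 * cstar f pM].
    move=> c0 tw.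
    have [x0 [r [fp left rr _ [_ jump dr _]]]] := wave_front pM_gt0 flip dF fcont fpM l01 tw.
    have [_ _ _ _ [_ rhol _ _]] := tw.
    have right : forall x, x0 < x -> rho x = l.
      apply: constant_tail rhol _ => x x0x.
      by have := dr c0 x x0x; rewrite f0 mul0r oppr0 mul0r.
    exists x0; split => //; apply: speed => //.
    by rewrite -jump (right_limit_eq rr right).
  split.
  + split.
      have [rho [p tw]] := constant_wave_exists pM_gt0 K0 flip dF fcont fpM Gp I0 l01
        (etrans (congr1 _ f0) (mulr0 l)).
      exists rho, p; eexists; last exact: tw.
      by rewrite -csE mulf_neq0 ?invr_neq0 ?gt_eqF.
    move=> rho1 p1 rho2 p2 [c1 c10 /(analysis _ _ _ c10)[x1 [fp1 l1' r1 _]]].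
    move=> [c2 c20 /(analysis _ _ _ c20)[x2 [fp2 l2 r2 _]]].
    exact: (constant_tail_translates dF Gp fp1 fp2 l1' l2 r1 r2).
  + by move=> c rho p c0 /(analysis _ _ _ c0)[x0 []].
  + have inv_ge1 : 1 <= (1 - l)^-1 by rewrite invf_ge1// gerBl.
    by rewrite ler_peMl// ltW.
Qed.
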